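(* Let $R^*\subset\mathbb{R}^2$ be a region bounded by a piecewise smooth simple closed curve, let $h_b$ be a boundary asymptotic height function on $\partial R^*$, and let $f$ be the maximizer of $\mathrm{Ent}$ over $\mathrm{AH}(R^*,h_b)$ (it exists and is unique). At every interior point of $R^*$ that has a neighborhood on which $f$ is $C^2$, and at which $|f_x|+|f_y|<2$, $f$ satisfies $$\Big(2(1-D^2)-\sin^2\big(\tfrac{\pi f_x}2\big)\Big)f_{xx}+2\sin\big(\tfrac{\pi f_x}2\big)\sin\big(\tfrac{\pi f_y}2\big)f_{xy}+\Big(2(1-D^2)-\sin^2\big(\tfrac{\pi f_y}2\big)\Big)f_{yy}=0,$$ where $D=\frac12\big(\cos(\pi f_x/2)-\cos(\pi f_y/2)\big)$.
   Context: A function defined on a subset of $\mathbb{R}^2$ is 2-Lipschitz if its domain is covered by open balls on each of which $|g(x_1,y_1)-g(x_2,y_2)|\le 2\max(|x_1-x_2|,|y_1-y_2|)$. A function $h_b:\partial R^*\to\mathbb{R}$ is a boundary asymptotic height function if it is the restriction of a 2-Lipschitz function on $R^*$. $\mathrm{AH}(R^*,h_b)$ is the set of 2-Lipschitz $h:R^*\to\mathbb{R}$ with $h|_{\partial R^*}=h_b$. These are differentiable almost everywhere with $|h_x|+|h_y|\le2$. For $|s|+|t|\le2$ set $p_a=\frac t4+\frac1{2\pi}\arccos\!\big(\tfrac{\cos(\pi t/2)-\cos(\pi s/2)}2\big)$, $p_b=-\frac t4+\frac1{2\pi}\arccos\!\big(\tfrac{\cos(\pi t/2)-\cos(\pi s/2)}2\big)$,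 $p_c=-\frac s4+\frac1{2\pi}\arccos\!\big(\tfrac{\cos(\pi s/2)-\cos(\pi t/2)}2\big)$, $p_d=\frac s4+\frac1{2\pi}\arccos\!\big(\tfrac{\cos(\pi s/2)-\cos(\pi t/2)}2\big)$, with $\arccos\in[0,\pi]$. Define $\mathrm{ent}(s,t)=\frac1\pi\sum_{x\in\{a,b,c,d\}}L(\pi p_x)$, where $L(z)=-\int_0^z\log|2\sin u|\,du$, and $\mathrm{Ent}(h)=\frac1{\mathrm{area}(R^* )}\iint_{R^*}\mathrm{ent}(h_x,h_y)\,dx\,dy$. *)

(* Defs.v *)
From mathcomp Require Import all_boot all_order all_algebra.
From mathcomp Require Import all_classical all_reals all_analysis.
Set Implicit Arguments.
Unset Strict Implicit.
Unset Printing Implicit Defensive.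
Import Order.TTheory GRing.Theory Num.Theory.
Import numFieldNormedType.Exports.
Local Open Scope classical_set_scope.
Local Open Scope ring_scope.

(* The plane is the product type R * R.  A function on a subset A of the plane
   is a total function R * R -> R of which only the values on A matter. *)

Section Plane.
Context {R : realType}.

Definition boundary (A : set (R * R)) : set (R * R) := closure A `\` interior A.

Definition ex : R * R := (1, 0).
Definition ey : R * R := (0, 1).
Definition dx (g : R * R -> R) : R * R -> R := fun q => 'D_ex g q.
Definition dy (g : R * R -> R) : R * R -> R := fun q => 'D_ey g q.

(* C^1 and C^2 on an open set U; without the derivability conditions 'D_v
   would be a default value. *)
Definition C1_on (U : set (R * R)) (g : R * R -> R) : Prop :=
  forall q, U q ->
    [/\ derivable g q ex, derivable g q ey,
        {for q, continuous (dx g)} & {for q, continuous (dy g)}].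

Definition C2_on (U : set (R * R)) (g : R * R -> R) : Prop :=
  [/\ C1_on U g, C1_on U (dx g) & C1_on U (dy g)].

(* On [a, b], gamma is the restriction of a C^1 curve with nonzero velocity. *)
Definition smooth_arc (gamma : R -> R * R) (a b : R) : Prop :=
  exists g : R -> R * R,
    [/\ forall u, derivable g u 1, continuous (derive1 g),
        forall u, a <= u <= b -> derive1 g u != 0 &
        forall u, a <= u <= b -> gamma u = g u].

Definition piecewise_smooth (gamma : R -> R * R) : Prop :=
  exists (n : nat) (t : nat -> R),
    [/\ t 0%N = 0, t n = 1 &
        forall i, (i < n)%N ->
          t i < t i.+1 /\ smooth_arc gamma (t i) (t i.+1)].

Definition simple_closed (gamma : R -> R * R) : Prop :=
  [/\ {within `[0, 1], continuous gamma}, gamma 0 = gamma 1 &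
      forall u v, 0 <= u < 1 -> 0 <= v < 1 -> gamma u = gamma v -> u = v].

(* A region is the closure of a bounded nonempty connected open set, so it
   contains its boundary, where the boundary heights are prescribed. *)
Definition region_bounded_by (A : set (R * R)) (gamma : R -> R * R) : Prop :=
  [/\ compact A, A = closure (interior A), interior A !=set0,
      connected (interior A) & boundary A = gamma @` `[0, 1]].

(* The balls of R * R are sup-norm balls; covering the domain by them or by
   Euclidean balls gives the same notion. *)
Definition lipschitz2 (A : set (R * R)) (g : R * R -> R) : Prop :=
  forall p, A p -> exists (c : R * R) (r : R),
    [/\ 0 < r, ball c r p &
        forall q1 q2, A q1 -> A q2 -> ball c r q1 -> ball c r q2 ->
          `|g q1 - g q2| <= 2 * Num.max `|q1.1 - q2.1| `|q1.2 - q2.2|].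

Definition boundary_asymptotic_height (A : set (R * R)) (hb : R * R -> R) :
    Prop :=
  exists g, lipschitz2 A g /\ forall q, boundary A q -> hb q = g q.

Definition AH (A : set (R * R)) (hb : R * R -> R) : set (R * R -> R) :=
  [set h | lipschitz2 A h /\ forall q, boundary A q -> h q = hb q].

(* The integral from 0 to z is oriented.  In the library ln 0 = 0, which only
   affects the null set of zeros of sin. *)
Definition log2sin (u : R) : R := ln `|2 * sin u|.

Definition lobachevsky (z : R) : R :=
  if 0 <= z then - \int[lebesgue_measure]_(u in `[0, z]) log2sin u
  else \int[lebesgue_measure]_(u in `[z, 0]) log2sin u.

Definition p_a (s t : R) : R :=
  t / 4 + (2 * pi)^-1 * acos ((cos (pi * t / 2) - cos (pi * s / 2)) / 2).
Definition p_b (s t : R) : R :=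
  - (t / 4) + (2 * pi)^-1 * acos ((cos (pi * t / 2) - cos (pi * s / 2)) / 2).
Definition p_c (s t : R) : R :=
  - (s / 4) + (2 * pi)^-1 * acos ((cos (pi * s / 2) - cos (pi * t / 2)) / 2).
Definition p_d (s t : R) : R :=
  s / 4 + (2 * pi)^-1 * acos ((cos (pi * s / 2) - cos (pi * t / 2)) / 2).

Definition ent (s t : R) : R :=
  pi^-1 * (lobachevsky (pi * p_a s t) + lobachevsky (pi * p_b s t)
         + lobachevsky (pi * p_c s t) + lobachevsky (pi * p_d s t)).

Definition area (A : set (R * R)) : R :=
  fine ((@lebesgue_measure R \x @lebesgue_measure R)%E A).

(* The integral runs over the interior: partial derivatives at a boundary point
   would depend on the values of h outside A, and the boundary of a region
   bounded by a piecewise smooth curve is a null set. *)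
Definition Ent (A : set (R * R)) (h : R * R -> R) : R :=
  (area A)^-1 *
  \int[(@lebesgue_measure R \x @lebesgue_measure R)%E]_(q in interior A)
    ent (dx h q) (dy h q).

Definition is_maximizer (A : set (R * R)) (hb f : R * R -> R) : Prop :=
  AH A hb f /\ forall h, AH A hb h -> Ent A h <= Ent A f.

End Plane.

(* Main.v *)
Require Import Defs.
From mathcomp Require Import all_boot all_order all_algebra.
From mathcomp Require Import all_classical all_reals all_analysis.
From mathcomp Require Import measurable_realfun ring lra.
Set Implicit Arguments.
Unset Strict Implicit.
Unset Printing Implicit Defensive.
Import Order.TTheory GRing.Theory Num.Theory.
Import numFieldNormedType.Exports.
Local Open Scope classical_set_scope.
Local Open Scope ring_scope.

(* Write X and Y for the partial derivatives of ent at grad f, so that the equation,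
   up to a nonzero factor, says T = 0 where T = X_x + Y_y at p. For a bump phi of
   small radius r around p, phi(x, y) = a(x - p_1) a(y - p_2) with
   a(u) = max(r^2 - u^2, 0)^2, the competitor f + e phi is admissible for small e.
   Replacing X and Y by their first-order expansions at p, the gain in entropy is
   e times the integral of X phi_x + Y phi_y, that is -e T (int a)^2, which is of
   order e T r^10, up to an error of smaller order. If T were nonzero, taking e small
   of the sign of -T would contradict maximality. Expanding at p replaces both
   integration by parts and differentiation under the integral sign. *)

(** * Functions of two variables *)

(** Smoothness of [f] is known only near [p]. Elsewhere its partial derivatives may be default
    values, and their measurability is not established. The two entropies are therefore never
    evaluated: their integrands are bounded and agree off a small square, and additivity over a
    measurable set, which holds for every bounded integrand on a set of finite measure, reduces the
    comparison to that square. The amplitude is tied to the radius. Each partial derivative of e phi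
    is at most 4 |e| r^7, and |e| is chosen to make this bound k r / 2, where k depends only on the
    accuracy wanted. The slopes then move little compared with r, so the intermediate points of the
    mean value theorem are absorbed into the expansion at p. Gain and error are both multiples of
    |e| r^10, with coefficients (16/15)^2 |T| and |T| / 2. In the integral of X phi_x + Y phi_y, the
    constant terms and the terms in X_y and Y_x vanish by parity. Sup-norm balls are squares and the
    bump is a product of polynomials there, so Fubini makes every integral explicit. *)

Section TwoVariables.
Context {R : realType}.
Implicit Types (g : R * R -> R) (p q : R * R) (W : set (R * R)).

Let quotient_ex g q : (fun h : R => h^-1 *: ((g \o shift q) (h *: ex) - g q)) =
  (fun h : R => h^-1 *: (((fun x => g (x, q.2)) \o shift q.1) (h *: (1 : R))
    - g (q.1, q.2))).
Proof.
apply/funext => h; congr (_ *: (g _ - g _)); last by case: q.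
by rewrite /shift/= /ex; case: q => a b /=; congr (_, _); rewrite /= scaler0 add0r.
Qed.

Let quotient_ey g q : (fun h : R => h^-1 *: ((g \o shift q) (h *: ey) - g q)) =
  (fun h : R => h^-1 *: (((fun y => g (q.1, y)) \o shift q.2) (h *: (1 : R))
    - g (q.1, q.2))).
Proof.
apply/funext => h; congr (_ *: (g _ - g _)); last by case: q.
by rewrite /shift/= /ey; case: q => a b /=; congr (_, _); rewrite /= scaler0 add0r.
Qed.

(** The difference quotients agree as functions of [h], so the equality also holds where the partial
    derivative does not exist; [slope_bound] uses it there. *)
Lemma dxE g q : dx g q = 'D_1 (fun x => g (x, q.2)) q.1.
Proof. by rewrite /dx /derive quotient_ex. Qed.

Lemma dyE g q : dy g q = 'D_1 (fun y => g (q.1, y)) q.2.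
Proof. by rewrite /dy /derive quotient_ey. Qed.

Lemma is_derive_exP g q d :
  is_derive q.1 (1 : R) (fun x => g (x, q.2)) d <-> is_derive q ex g d.
Proof.
split=> -[D <-]; split.
- by move: D; rewrite /derivable quotient_ex.
- exact: dxE.
- by move: D; rewrite /derivable quotient_ex.
- by rewrite -dxE.
Qed.

Lemma is_derive_eyP g q d :
  is_derive q.2 (1 : R) (fun y => g (q.1, y)) d <-> is_derive q ey g d.
Proof.
split=> -[D <-]; split.
- by move: D; rewrite /derivable quotient_ey.
- exact: dyE.
- by move: D; rewrite /derivable quotient_ey.
- by rewrite -dyE.
Qed.

(** The partial derivatives are given as functions so that closed forms such as [ent1] fit;
    [is_derive] includes existence, which an equation for [dx g] would not. *)
Definition grad_on W g g1 g2 :=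
  forall q, W q -> is_derive q ex g (g1 q) /\ is_derive q ey g (g2 q).

Lemma MVT_between (f df : R -> R) (a b : R) :
  (forall x, Num.min a b <= x <= Num.max a b -> is_derive x 1 f (df x)) ->
  exists2 c, Num.min a b <= c <= Num.max a b & f b - f a = df c * (b - a).
Proof.
wlog ab : a b / a <= b.
  move=> H; have [ab|/ltW ba] := leP a b.
    by have := H _ _ ab; rewrite min_l// max_r.
  move=> D; have [|c cab E] := H _ _ ba.
    by move=> x; rewrite minC maxC min_r// max_l//; exact: D.
  exists c; first by move: cab; rewrite minC maxC min_r// max_l.
  by rewrite -opprB E -mulrN opprB.
rewrite min_l// max_r// => D.
have [||c cab E] := @MVT_segment R f df a b ab.
- by move=> x; rewrite in_itv/= => /andP[/ltW ? /ltW ?]; apply: D; apply/andP.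
- apply: derivable_within_continuous => x; rewrite in_itv/= => /D.
  by case.
- by exists c; rewrite ?in_itv in cab *.
Qed.

(** A horizontal step is followed by a vertical one: the corner [(q'.1, q.2)] stays in the ball
    because sup-norm balls are products of intervals. Each leg has its own intermediate point. *)
Lemma axis_mvt W g g1 g2 c r q q' :
  grad_on W g g1 g2 -> ball c r `<=` W -> ball c r q -> ball c r q' ->
  exists xi1 xi2, [/\ ball c r xi1, ball c r xi2 &
    g q' - g q = g1 xi1 * (q'.1 - q.1) + g2 xi2 * (q'.2 - q.2)].
Proof.
move=> G BW [q1 q2] [q1' q2'].
have btw (u v w x : R) : `|u - v| < r -> `|u - w| < r ->
    Num.min v w <= x <= Num.max v w -> `|u - x| < r.
  rewrite ge_min le_max => + + /andP[/orP[] ? /orP[] ?];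
  rewrite !ltr_distl => /andP[? ?] /andP[? ?]; apply/andP; split; lra.
have [|x xq Ex] := @MVT_between (fun x => g (x, q.2)) (fun x => g1 (x, q.2)) q.1 q'.1.
  move=> x xq; apply/(@is_derive_exP g (x, q.2)).
  by apply: (G _ _).1; apply: BW; split => //=; exact: btw xq.
have [|y yq Ey] := @MVT_between (fun y => g (q'.1, y)) (fun y => g2 (q'.1, y)) q.2 q'.2.
  move=> y yq; apply/(@is_derive_eyP g (q'.1, y)).
  by apply: (G _ _).2; apply: BW; split => //=; exact: btw yq.
exists (x, q.2), (q'.1, y); split.
- by split => //=; exact: btw xq.
- by split => //=; exact: btw yq.
- rewrite -Ex -Ey.
  by move: q q' {q1 q2 q1' q2' Ex Ey xq yq} => [? ?] [? ?] /=; ring.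
Qed.

Lemma continuous_pairP g p : {for p, continuous g} <->
  forall e : R, 0 < e -> exists2 d : R, 0 < d & forall q, ball p d q -> `|g p - g q| < e.
Proof.
split.
  move=> /cvgrPdist_lt gp e e0; have /nbhs_ballP[d /= d0 H] : nbhs p
    [set t | `|g p - g t| < e] := gp _ e0.
  by exists d => // q /H.
move=> H; apply/cvgrPdist_lt => e e0; have [d d0 dH] := H e e0.
by apply/(nbhs_ballP p); exists d => // q /dH.
Qed.

Lemma taylor1 W g g1 g2 p : open W -> W p -> grad_on W g g1 g2 ->
  {for p, continuous g1} -> {for p, continuous g2} ->
  forall e : R, 0 < e -> exists2 d : R, 0 < d & forall (rho : R) q, rho <= d ->
    ball p rho q ->
    `|g q - g p - (g1 p * (q.1 - p.1) + g2 p * (q.2 - p.2))| <= e * rho.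
Proof.
move=> oW Wp G /continuous_pairP c1 /continuous_pairP c2 e e0.
have e20 : 0 < e / 2 by rewrite divr_gt0.
have [d1 d10 H1] := c1 _ e20; have [d2 d20 H2] := c2 _ e20.
have : nbhs p W by exact: open_nbhs_nbhs.
move=> /nbhs_ballP[d3 /= d30 H3].
exists (Num.min d3 (Num.min d1 d2)); first by rewrite !lt_min d10 d20 d30.
move=> rho q; rewrite !le_min => /and3P[r3 r1 r2] pq.
have r0 : 0 < rho by case: pq => /(le_lt_trans (normr_ge0 _)).
have [|x1 [x2 [bx1 bx2 ->]]] := axis_mvt G _ (ballxx p r0) pq.
  exact: subset_trans (le_ball r3) H3.
have {}H1 := H1 _ (le_ball r1 bx1); have {}H2 := H2 _ (le_ball r2 bx2).
case: pq => p1 p2.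
rewrite (_ : _ - _ = (g1 x1 - g1 p) * (q.1 - p.1) + (g2 x2 - g2 p) * (q.2 - p.2));
  last by ring.
rewrite (le_trans (ler_normD _ _))// !normrM.
rewrite [e]splitr mulrDl lerD// ler_pM// ltW// distrC//.
Qed.

Lemma grad_continuous W g g1 g2 p : open W -> W p -> grad_on W g g1 g2 ->
  {for p, continuous g1} -> {for p, continuous g2} -> {for p, continuous g}.
Proof.
move=> oW Wp G c1 c2; apply/continuous_pairP => e e0.
have [d d0 H] := taylor1 oW Wp G c1 c2 ltr01.
(* [taylor1] with tolerance 1 bounds the increment by [(M - 1) * rho]; the extra unit makes the
   inequality strict. *)
pose M := `|g1 p| + `|g2 p| + 2.
have M0 : 0 < M by rewrite /M ltr_wpDl// addr_ge0.
exists (Num.min d (e / M)); first by rewrite lt_min d0 divr_gt0.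
set rho := Num.min _ _ => q pq.
have := H rho q _ pq; rewrite ge_min lexx => /(_ isT).
have rM : rho * M <= e by rewrite -ler_pdivlMr// /rho ge_min lexx orbT.
have r0 : 0 < rho by case: pq => /(le_lt_trans (normr_ge0 _)).
case: pq => p1 p2; rewrite mul1r => K.
have K1 : `|g1 p * (q.1 - p.1)| <= `|g1 p| * rho.
  by rewrite normrM ler_wpM2l// distrC ltW.
have K2 : `|g2 p * (q.2 - p.2)| <= `|g2 p| * rho.
  by rewrite normrM ler_wpM2l// distrC ltW.
rewrite distrC; apply: lt_le_trans rM.
rewrite (_ : g q - g p = (g q - g p - (g1 p * (q.1 - p.1) + g2 p * (q.2 - p.2)))
  + g1 p * (q.1 - p.1) + g2 p * (q.2 - p.2)); last by ring.
have := ler_normD (g q - g p - (g1 p * (q.1 - p.1) + g2 p * (q.2 - p.2))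
  + g1 p * (q.1 - p.1)) (g2 p * (q.2 - p.2)).
have := ler_normD (g q - g p - (g1 p * (q.1 - p.1) + g2 p * (q.2 - p.2)))
  (g1 p * (q.1 - p.1)).
rewrite /M; lra.
Qed.

(** By the mean value theorem applied in the two orders, the second difference of [f] over a square
    of side [h] with corner [p] is [h ^+ 2] times a value of [fxy] and also [h ^+ 2] times a value
    of [fyx], both taken in the square. *)
Lemma schwarz W f fx fy fxx fxy fyx fyy p : open W -> W p ->
  grad_on W f fx fy -> grad_on W fx fxx fxy -> grad_on W fy fyx fyy ->
  {for p, continuous fxy} -> {for p, continuous fyx} -> fxy p = fyx p.
Proof.
move=> oW Wp G Gx Gy /continuous_pairP cxy /continuous_pairP cyx.
apply/eqP; rewrite -subr_eq0 -normr_le0; apply/ler_addgt0Pr => e e0.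
have e20 : 0 < e / 2 by rewrite divr_gt0.
have [d1 d10 H1] := cxy _ e20; have [d2 d20 H2] := cyx _ e20.
have /nbhs_ballP[d3 /= d30 H3] : nbhs p W by exact: open_nbhs_nbhs.
pose d := Num.min d3 (Num.min d1 d2); pose h := d / 2.
have d0 : 0 < d by rewrite /d !lt_min d10 d20 d30.
have h0 : 0 < h by rewrite divr_gt0.
have near (u x : R) : Num.min u (u + h) <= x <= Num.max u (u + h) -> `|u - x| < d.
  rewrite min_l ?lerDl ?(ltW h0)// max_r ?lerDl ?(ltW h0)// => /andP[ux xu].
  rewrite distrC ger0_norm ?subr_ge0//; rewrite /h in xu; lra.
have near0 u : `|u - u| < d by rewrite subrr normr0.
have nearh (u : R) : `|u - (u + h)| < d.
  by apply: near; rewrite le_max lexx orbT ge_min lexx orbT.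
have BW q : ball p d q -> W q by move=> pq; apply: H3; apply: le_ball pq;
  rewrite /d ge_min lexx.
pose Delta := f (p.1 + h, p.2 + h) - f (p.1 + h, p.2) - f (p.1, p.2 + h) + f (p.1, p.2).
have [|x px Ex] := @MVT_between (fun x => f (x, p.2 + h) - f (x, p.2))
    (fun x => fx (x, p.2 + h) - fx (x, p.2)) p.1 (p.1 + h).
  move=> x px; apply: is_deriveB.
    by apply/(@is_derive_exP f (x, p.2 + h)); apply: (G _ _).1; apply: BW; split;
      [exact: near|exact: nearh].
  by apply/(@is_derive_exP f (x, p.2)); apply: (G _ _).1; apply: BW; split;
    [exact: near|exact: near0].
have [|y py Ey] := @MVT_between (fun y => fx (x, y)) (fun y => fxy (x, y)) p.2 (p.2 + h).
  move=> y py; apply/(@is_derive_eyP fx (x, y)); apply: (Gx _ _).2.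
  by apply: BW; split; exact: near.
have [|y' py' Ey'] := @MVT_between (fun y => f (p.1 + h, y) - f (p.1, y))
    (fun y => fy (p.1 + h, y) - fy (p.1, y)) p.2 (p.2 + h).
  move=> y' py'; apply: is_deriveB.
    by apply/(@is_derive_eyP f (p.1 + h, y')); apply: (G _ _).2; apply: BW; split;
      [exact: nearh|exact: near].
  by apply/(@is_derive_eyP f (p.1, y')); apply: (G _ _).2; apply: BW; split;
    [exact: near0|exact: near].
have [|x' px' Ex'] := @MVT_between (fun x => fy (x, y')) (fun x => fyx (x, y')) p.1
  (p.1 + h).
  move=> x' px'; apply/(@is_derive_exP fy (x', y')); apply: (Gy _ _).1.
  by apply: BW; split; exact: near.
have : fxy (x, y) = fyx (x', y').
  apply: (@mulIf _ h); first by rewrite gt_eqF.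
  apply: (@mulIf _ h); first by rewrite gt_eqF.
  have [hx hy] : p.1 + h - p.1 = h /\ p.2 + h - p.2 = h by split; ring.
  rewrite hx in Ex Ex'; rewrite hy in Ey Ey'.
  rewrite -Ey -Ex' -Ex -Ey'; ring.
have : ball p d (x, y) by split; exact: near.
have : ball p d (x', y') by split; exact: near.
have [dd1 dd2] : d <= d1 /\ d <= d2 by rewrite /d !ge_min !lexx !orbT.
move=> /(le_ball dd2)/H2 K2 /(le_ball dd1)/H1 K1 E.
rewrite (_ : _ - _ = (fxy p - fxy (x, y)) - (fyx p - fyx (x', y')));
  last by rewrite E; ring.
by rewrite (le_trans (ler_normB _ _))// add0r [e]splitr lerD// ltW.
Qed.

Lemma ler_norm_add2 (x y a b : R) : `|x| <= a -> `|y| <= b -> `|x + y| <= a + b.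
Proof. by move=> xa yb; rewrite (le_trans (ler_normD _ _))// lerD. Qed.

(** The argument [xi] may miss [(u q, v q)] by [k * r], because the mean value theorem in
    [first_variation] produces such points; a displacement that is small relative to [r] fits into
    the error. *)
Lemma taylor_comp W V (E E1 E2 u u1 u2 v v1 v2 : R * R -> R) p :
  open W -> W p -> grad_on W u u1 u2 -> grad_on W v v1 v2 ->
  {for p, continuous u1} -> {for p, continuous u2} ->
  {for p, continuous v1} -> {for p, continuous v2} ->
  let P := (u p, v p) in
  open V -> V P -> grad_on V E E1 E2 ->
  {for P, continuous E1} -> {for P, continuous E2} ->
  forall e : R, 0 < e -> exists2 k : R, 0 < k & exists2 d : R, 0 < d &
    forall (r : R) q xi, r <= d -> ball p r q -> ball (u q, v q) (k * r) xi ->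
    `|E xi - E P - ((E1 P * u1 p + E2 P * v1 p) * (q.1 - p.1)
                  + (E1 P * u2 p + E2 P * v2 p) * (q.2 - p.2))| <= e * r.
Proof.
move=> oW Wp Gu Gv cu1 cu2 cv1 cv2 P oV VP GE cE1 cE2 e e0.
(* [M * r] will bound the distance from [P] to [xi]: the slopes of [u] and [v], one unit for their
   Taylor errors, one for the displacement of [xi], and one for strictness. *)
pose M := `|u1 p| + `|u2 p| + `|v1 p| + `|v2 p| + 3.
pose N := `|E1 P| + `|E2 P| + 1.
have M0 : 0 < M by rewrite /M ltr_wpDl// !addr_ge0.
have N0 : 0 < N by rewrite /N ltr_wpDl// !addr_ge0.
(* Four error terms of size [k * r] occur, two weighted by [E1 P] and two by [E2 P]. This choice
   keeps their sum below [e / 2 * r]; expanding [E] itself costs [e / 4 * r]. *)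
pose k := Num.min 1 (e / (4 * N)).
have k0 : 0 < k by rewrite lt_min ltr01 divr_gt0// mulr_gt0.
have k1 : k <= 1 by rewrite /k ge_min lexx.
have kN : k * N <= e / 4.
  by rewrite -ler_pdivlMr// -mulrA -invfM /k ge_min lexx orbT.
have eM0 : 0 < e / (4 * M) by rewrite divr_gt0// mulr_gt0.
have [du du0 Hu] := taylor1 oW Wp Gu cu1 cu2 k0.
have [dv dv0 Hv] := taylor1 oW Wp Gv cv1 cv2 k0.
have [dE dE0 HE] := taylor1 oV VP GE cE1 cE2 eM0.
exists k => //; exists (Num.min (dE / M) (Num.min du dv)).
  by rewrite !lt_min divr_gt0// du0.
move=> r q xi; rewrite !le_min => /and3P[rE ru rv] pq [x1 x2].
have r0 : 0 < r by case: pq => /(le_lt_trans (normr_ge0 _)).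
have {}Hu := Hu _ _ ru pq; have {}Hv := Hv _ _ rv pq.
case: (pq) => p1 p2; rewrite /= in x1 x2.
have bnd (a b c c' : R) : `|c - c' - (a * (q.1 - p.1) + b * (q.2 - p.2))| <= k * r ->
    `|c - c'| <= (`|a| + `|b| + 1) * r.
  move=> H; rewrite (_ : c - c' = (c - c' - (a * (q.1 - p.1) + b * (q.2 - p.2))) +
    (a * (q.1 - p.1) + b * (q.2 - p.2))); last by ring.
  rewrite (_ : (`|a| + `|b| + 1) * r = r + (`|a| * r + `|b| * r)); last by ring.
  apply: ler_norm_add2.
    by rewrite (le_trans H)// ler_piMl// ltW.
  by apply: ler_norm_add2; rewrite normrM ler_wpM2l// distrC ltW.
have bu := bnd _ _ _ _ Hu; have bv := bnd _ _ _ _ Hv.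
have krr : k * r <= r by rewrite ler_piMl// ltW.
have Pxi : ball P (M * r) xi.
  have := normr_ge0 (v1 p); have := normr_ge0 (v2 p).
  have := normr_ge0 (u1 p); have := normr_ge0 (u2 p) => U2 U1 V2 V1.
  have H (a b c c' z : R) : a + b + 2 < M -> `|c - c'| <= (a + b + 1) * r ->
      `|c - z| < k * r -> `|c' - z| < M * r.
    move=> abM cc cz; apply: le_lt_trans (ler_distD c _ _) _; rewrite distrC.
    apply: le_lt_trans (lerD cc (le_trans (ltW cz) krr)) _.
    by rewrite -[X in _ + X]mul1r -mulrDl ltr_pM2r//; move: abM; lra.
  by split; [apply: H bu x1|apply: H bv x2]; rewrite /M; lra.
have {}HE := HE (M * r) xi _ Pxi.
have {HE} HE : `|E xi - E P - (E1 P * (xi.1 - P.1) + E2 P * (xi.2 - P.2))| <= e / 4 * r.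
  rewrite (_ : e / 4 * r = e / (4 * M) * (M * r)); last by field; rewrite gt_eqF.
  by apply: HE; rewrite mulrC -ler_pdivlMr.
rewrite (_ : _ - _ = (E xi - E P - (E1 P * (xi.1 - P.1) + E2 P * (xi.2 - P.2)))
  + (E1 P * (xi.1 - u q) + E1 P * (u q - u p - (u1 p * (q.1 - p.1) + u2 p * (q.2 - p.2))))
  + (E2 P * (xi.2 - v q) + E2 P * (v q - v p - (v1 p * (q.1 - p.1) + v2 p * (q.2 - p.2)))));
  last by rewrite /P/=; ring.
apply: (@le_trans _ _ (e / 4 * r + (`|E1 P| * (k * r) + `|E1 P| * (k * r))
    + (`|E2 P| * (k * r) + `|E2 P| * (k * r)))).
  by do !apply: ler_norm_add2 => //; rewrite normrM ler_wpM2l// distrC ltW.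
have : k * N * r <= e / 4 * r by rewrite ler_pM2r.
have : 0 <= k * r by rewrite mulr_ge0 ?ltW.
have : 0 <= e * r by rewrite mulr_ge0 ?ltW.
rewrite /N; set A := `|E1 P|; set B := `|E2 P|.
rewrite (_ : k * (A + B + 1) * r = k * r * A + k * r * B + k * r); last by ring.
rewrite (mulrC A) (mulrC B) mulrAC; lra.
Qed.

End TwoVariables.

(** * The Lobachevsky function *)

Section Singular.
Context {R : realType}.
Notation mu := (@lebesgue_measure R).

(** On inner segments the integral is a difference of two values of [K], hence at most [M + M];
    monotone convergence carries this bound to the whole interval, whatever the singularities of [k]
    at its ends. *)
Lemma integrable_oo_FTC (a b M : R) (k K : R -> R) : a < b ->
  (forall x, a < x < b -> is_derive x 1 K (k x)) ->
  (forall x, a < x < b -> {for x, continuous k}) ->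
  (forall x, a < x < b -> 0 <= k x) -> (forall x, a < x < b -> `|K x| <= M) ->
  mu.-integrable `]a, b[ (EFin \o k).
Proof.
move=> ab DK ck k0 KM.
have mk : measurable_fun `]a, b[ k.
  apply: open_continuous_measurable_fun; first exact: interval_open.
  by move=> x; rewrite inE/= in_itv/= => /ck.
(* The shift by 3 keeps [d n] at most a third of the length, so that every segment is
   nondegenerate. *)
pose d n : R := (b - a) / n.+3%:R.
have ba : 0 < b - a by rewrite subr_gt0.
have d0 n : 0 < d n by rewrite divr_gt0.
have d3 n : d n <= (b - a) / 3.
  by rewrite ler_pM2l// lef_pV2 ?posrE// ler_nat.
pose F n := `[a + d n, b - d n]%classic.
have Fin n x : F n x -> a < x < b.
  rewrite /F/= in_itv/= => /andP[ax xb].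
  rewrite (lt_le_trans _ ax) ?ltrDl//= (le_lt_trans xb)// ltrBlDr ltrDl//.
have FE : `]a, b[%classic = \bigcup_n F n.
  rewrite eqEsubset; split => x; last first.
    by move=> [n _ /Fin]; rewrite /= in_itv.
  rewrite /= in_itv/= => /andP[ax xb].
  pose m := Num.min (x - a) (b - x).
  have m0 : 0 < m by rewrite lt_min !subr_gt0 ax.
  have [n] : exists n, d n <= m.
    exists (Num.truncn ((b - a) / m)).
    rewrite /d ler_pdivrMr// mulrC -ler_pdivrMr//.
    by rewrite (le_trans (ltW (truncnS_gt _)))// ler_nat; do 2 apply: leqW.
  rewrite /m le_min => /andP[n1 n2]; exists n => //.
  rewrite /F/= in_itv/=; apply/andP; split; move: n1 n2; rewrite -/(d n); lra.
apply/integrableP; split; first exact/measurable_EFinP.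
rewrite (_ : (\int[_]_(x in _) _)%E = (\int[mu]_(x in `]a, b[) (k x)%:E)%E); last first.
  apply: eq_integral => x; rewrite inE/= in_itv/= => xab.
  by rewrite ger0_norm// k0.
rewrite FE; apply: (@le_lt_trans _ _ (M + M)%:E); last exact: ltry.
apply: (cvge_to_le (ge0_nondecreasing_set_cvg_integral _ _ _ _)).
- move=> m n mn; apply/subsetPset => x; rewrite /F/= !in_itv/=.
  have : d n <= d m by rewrite /d ler_pM2l// lef_pV2 ?posrE// ler_nat.
  by move=> dnm /andP[ax xb]; apply/andP; split; move: ax xb; lra.
- by move=> n; exact: measurable_itv.
- move=> n; apply/measurable_EFinP; apply: measurable_funS mk => //.
  by move=> x /Fin; rewrite /= in_itv.
- by move=> n x /Fin/k0; rewrite lee_fin.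
near=> n.
have adbd : a + d n < b - d n by have := d3 n; have := d0 n; lra.
have ban x : a + d n <= x <= b - d n -> a < x < b.
  by move=> H; apply: (Fin n); rewrite /F/= in_itv.
rewrite (@continuous_FTC2 _ _ K)//.
- rewrite -EFinB lee_fin (le_trans (ler_norm _))// (le_trans (ler_normB _ _))// lerD//.
    by rewrite KM// ban// lexx andbT ltW.
  by rewrite KM// ban// lexx ltW.
- apply: continuous_in_subspaceT => x; rewrite inE/= in_itv/= => xn.
  exact/ck/ban.
- split.
  + by move=> x; rewrite in_itv/= => /andP[/ltW ? /ltW ?];
    have [] := DK x (ban _ _) => //; apply/andP.
  + apply: cvg_at_right_filter; apply/differentiable_continuous/derivable1_diffP.
    by have [] := DK (a + d n) (ban _ _) => //; rewrite lexx ltW.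
  + apply: cvg_at_left_filter; apply/differentiable_continuous/derivable1_diffP.
    by have [] := DK (b - d n) (ban _ _) => //; rewrite lexx ltW.
- move=> x; rewrite in_itv/= => /andP[/ltW ? /ltW ?]; rewrite derive1E.
  have xab : a + d n <= x <= b - d n by apply/andP.
  by case: (DK x (ban x xab)).
Unshelve. all: by end_near. Qed.

Lemma sin_lower_bound (u : R) : 0 < u < pi -> Num.min u (pi - u) / 4 <= sin u.
Proof.
wlog uh : u / u <= pi / 2.
  move=> H u0; have [|hu] := leP u (pi / 2); first by move=> uh; exact: H.
  have := H (pi - u); rewrite subKr minC sinB sinpi cospi mul0r sub0r mulN1r opprK.
  by apply; lra.
move=> /andP[u0 _].
have u2 : u <= 2 by apply: (le_trans uh); have /andP[] := (pihalf_02_cos_pihalf R).1.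
rewrite min_l; last by lra.
have s0 : 0 < sin u by apply: sin_gt0_pi; lra.
have c0 : 0 <= cos u by apply: cos_ge0_pihalf; have := pi_ge0 R; lra.
(* If the cosine is below 1/2, the sine exceeds 1/2, which is at least [u / 4] since [u <= 2].
   Otherwise the cosine is at least 1/2 on all of [0, u], and the mean value theorem gives
   [sin u >= u / 2]. *)
have [c|c] := ltP (cos u) (1 / 2).
  have := cos2Dsin2 u; nra.
have [|x] := @MVT_segment R sin cos 0 u (ltW u0).
  by apply: continuous_subspaceT; exact: continuous_sin.
rewrite in_itv/= => /andP[x0 xu]; rewrite sin0 !subr0 => ->.
have : cos u <= cos x.
  by rewrite leNgt ltr_cos -?leNgt// in_itv/=; apply/andP; split; lra.
nra.
Qed.

(** For the lower bound, [- ln w] is twice the logarithm of the inverse square root of [w], and a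
    logarithm is below its argument. This trades the logarithmic singularity for one with an
    elementary primitive. *)
Lemma norm_ln_le (w : R) : 0 < w -> `|ln w| <= 2 * (Num.sqrt w)^-1 + w.
Proof.
move=> w0; have s0 : 0 < Num.sqrt w by rewrite sqrtr_gt0.
rewrite ler_norml; apply/andP; split; last first.
  by rewrite (le_trans (ltW (ln_sublinear w0)))// lerDr mulr_ge0// invr_ge0 ltW.
have := @ln_sublinear _ (Num.sqrt w)^-1; rewrite invr_gt0 => /(_ s0).
have -> : ln w = ln (Num.sqrt w) *+ 2 by rewrite -lnXn// sqr_sqrtr// ltW.
rewrite lnV ?posrE//.
set t := (Num.sqrt w)^-1; set l := ln _; lra.
Qed.

(* [ln |2 sin x|] is dominated by [8 * k x], where [k] has the bounded
   antiderivative [K]. *)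
Lemma integrable_log2sin : mu.-integrable `[0, pi] (EFin \o log2sin).
Proof.
have pi0 : 0 < pi :> R by rewrite pi_gt0.
have pi4 : pi <= 4 :> R.
  have /andP[_] := (pihalf_02_cos_pihalf R).1; lra.
have mlog : measurable_fun setT (@log2sin R).
  apply: measurableT_comp; first exact: measurable_ln.
  apply: measurableT_comp => //; apply: measurable_funM => //.
  by apply: continuous_measurable_fun; exact: continuous_sin.
pose k (x : R) := (Num.sqrt x)^-1 + (Num.sqrt (pi - x))^-1.
pose K (x : R) := 2 * Num.sqrt x - 2 * Num.sqrt (pi - x).
have s0 (x : R) : 0 < x < pi -> 0 < Num.sqrt x /\ 0 < Num.sqrt (pi - x).
  by move=> /andP[x0 xpi]; rewrite !sqrtr_gt0 subr_gt0.
have ik : mu.-integrable `]0, pi[ (EFin \o k).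
  apply: (@integrable_oo_FTC 0 pi (4 * Num.sqrt pi) k K) => // x xpi.
  - have [x0 x1] := s0 _ xpi.
    have D1 : is_derive x 1 (fun x => Num.sqrt (pi - x))
      ((2 * Num.sqrt (pi - x))^-1 * (0 - 1)).
      apply: (@is_derive1_comp _ Num.sqrt (fun x => pi - x)).
      by apply: is_derive1_sqrt; case/andP: xpi; rewrite subr_gt0.
    have D2 : is_derive x 1 Num.sqrt (2 * Num.sqrt x)^-1.
      by apply: is_derive1_sqrt; case/andP: xpi.
    apply: (is_derive_eq (is_deriveB (is_deriveZ 2 D2) (is_deriveZ 2 D1))).
    rewrite /k /GRing.scale/=; field.
    by rewrite !gt_eqF.
  - have [x0 x1] := s0 _ xpi.
    apply: cvgD; (apply: cvgV; first by rewrite gt_eqF); first exact: sqrt_continuous.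
    apply: continuous_comp; last exact: sqrt_continuous.
    by apply: cvgB; [exact: cvg_cst|exact: cvg_id].
  - by rewrite addr_ge0// invr_ge0 sqrtr_ge0.
  - have [x0 x1] := s0 _ xpi.
    have [/ltW xp xp'] : x < pi /\ pi - x <= pi by case/andP: xpi => ? ?; lra.
    have := ler_wsqrtr xp; have := ler_wsqrtr xp'.
    rewrite /K ler_norml; move=> ? ?; apply/andP; split; lra.
have io : mu.-integrable `]0, pi[ (EFin \o log2sin).
  have : mu.-integrable `]0, pi[ (EFin \o (fun x => 8 * k x)).
    rewrite (_ : _ \o _ = (fun x => 8%:E * (EFin \o k) x)%E).
      by apply: integrableZl => //; exact: measurable_itv.
    by apply/funext => x /=; rewrite EFinM.
  apply: le_integrable => //.
    by apply/measurable_EFinP; exact: measurable_funTS.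
  move=> x; rewrite /= in_itv/= => xpi; rewrite lee_fin.
  have [x0 x1] := s0 _ xpi.
  have k0 : 0 <= k x by rewrite addr_ge0// invr_ge0 sqrtr_ge0.
  have sin0 : 0 < sin x by exact: sin_gt0_pi.
  rewrite (ger0_norm (mulr_ge0 _ k0))// /log2sin.
  have sin20 : 0 < 2 * sin x by rewrite mulr_gt0.
  rewrite (ger0_norm (ltW sin20)).
  rewrite (le_trans (norm_ln_le sin20))//.
  have sk : (Num.sqrt (2 * sin x))^-1 <= 2 * k x.
    have bnd (t : R) : 0 < t -> t / 4 <= sin x ->
      (Num.sqrt (2 * sin x))^-1 <= 2 * (Num.sqrt t)^-1.
      move=> t0 ts; have t1 : 0 < Num.sqrt t by rewrite sqrtr_gt0.
      have -> : 2 * (Num.sqrt t)^-1 = (2^-1 * Num.sqrt t)^-1 by rewrite invfM invrK.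
      rewrite lef_pV2 ?posrE ?sqrtr_gt0 ?mulr_gt0//.
      have -> : 2^-1 * Num.sqrt t = Num.sqrt ((2^-1 * Num.sqrt t) ^+ 2).
        by rewrite sqrtr_sqr ger0_norm// mulr_ge0// ltW.
      by rewrite ler_wsqrtr// exprMn sqr_sqrtr ?ltW//; lra.
    have i0 : 0 < (Num.sqrt x)^-1 by rewrite invr_gt0.
    have i1 : 0 < (Num.sqrt (pi - x))^-1 by rewrite invr_gt0.
    have := sin_lower_bound xpi.
    have [px|px] := leP x (pi - x) => /bnd; rewrite /k.
      by case/andP: xpi => xp _ /(_ xp); lra.
    by case/andP: xpi => _ xp; rewrite subr_gt0 => /(_ xp); lra.
  (* [norm_ln_le] leads to [4 * k x + 2 * sin x]; since [k x >= 1 / 2], which rests on [pi <= 4], a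
     second [4 * k x] absorbs the sine. *)
  have k2 : 1 / 2 <= k x.
    rewrite /k ler_wpDr ?invr_ge0 ?sqrtr_ge0// div1r lef_pV2 ?posrE//.
    have -> : 2 = Num.sqrt 4 :> R by rewrite (_ : 4 = 2 ^+ 2) ?sqrtr_sqr ?ger0_norm//; ring.
    by apply: ler_wsqrtr; case/andP: xpi => _ /ltW /le_trans; apply.
  have := sin_le1 x; lra.
move/integrableP : io => [_ io]; apply/integrableP; split.
  by apply/measurable_EFinP; exact: measurable_funTS.
rewrite integral_itv_bndoo//.
by apply: measurableT_comp => //; apply/measurable_EFinP; exact: measurable_funTS.
Qed.

Lemma lobachevskyE z : 0 <= z -> lobachevsky z = - \int[mu]_(u in `[0, z]) log2sin u :> R.
Proof. by rewrite /lobachevsky => ->. Qed.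

Lemma lobachevsky_bounded : exists M : R, forall z, 0 <= z <= pi -> `|lobachevsky z| <= M.
Proof.
exists (\int[mu]_(u in `[0, pi]) `|log2sin u|) => z /andP[z0 zpi].
have sub : `[0, z]%classic `<=` `[0, pi : R]%classic.
  by move=> x; rewrite /= !in_itv/= => /andP[-> xz]; exact: le_trans zpi.
have iz : mu.-integrable `[0, z] (EFin \o log2sin).
  by apply: integrableS integrable_log2sin => //; exact: measurable_itv.
rewrite lobachevskyE// normrN.
apply: le_trans (le_normr_Rintegral _ iz) _ => //.
have ip := integrable_norm integrable_log2sin.
rewrite /Rintegral fine_le//.
- apply: integrable_fin_num => //; exact: integrableS ip.
- exact: integrable_fin_num.
- apply: ge0_subset_integral => //; first by case/integrableP : ip.
Qed.

Lemma is_derive_lobachevsky (z : R) : 0 < z < pi ->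
  is_derive z 1 (@lobachevsky R) (- ln (2 * sin z)).
Proof.
move=> zpi; have sz := sin_gt0_pi zpi; case/andP: (zpi) => z0 zp.
have c : {for z, continuous (@log2sin R)}.
  have C1 : {for z, continuous (fun x : R => `|2 * sin x|)}.
    apply: cvg_norm; apply: cvgM; first exact: cvg_cst.
    exact: continuous_sin.
  apply: (@continuous_comp _ _ _ (fun x : R => `|2 * sin x|) (@ln R)) => //.
  by apply: continuous_ln; rewrite normr_gt0 mulf_neq0// gt_eqF.
have [D E] := continuous_FTC1_closed zp integrable_log2sin z0 c.
have {D E} : is_derive z 1 (fun x => - \int[mu]_(u in `[0, x]) log2sin u) (- log2sin z).
  apply: is_deriveN; split; first exact: D.
  by rewrite -derive1E.
rewrite {2}/log2sin ger0_norm; last by rewrite mulr_ge0// ltW.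
apply: near_eq_is_derive; near=> x; rewrite lobachevskyE//.
by apply: ltW; near: x; exact: lt_nbhsr.
Unshelve. all: by end_near. Qed.

End Singular.

(** * The gradient and the Hessian of the entropy *)

Section Entropy.
Context {R : realType}.
Implicit Types s t : R.

Definition ent_dom : set (R * R) := [set q | `|q.1| + `|q.2| < 2].

Let c s := cos (pi * s / 2).
Let Dd s t := (c s - c t) / 2.

(** [- c t] is the cosine of pi - pi |t| / 2, so the condition on |s| + |t| says that this angle is
    at least pi |s| / 2, and the cosine decreases on [0, pi]. *)
Lemma cosDcos_ge0 s t : `|s| + `|t| <= 2 -> 0 <= c s + c t.
Proof.
move=> st; have pi0 := pi_gt0 R; have := normr_ge0 s; have := normr_ge0 t => t0 s0.
have abs (x : R) : c x = cos (pi * `|x| / 2).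
  by rewrite /c; case: ger0P => // _; rewrite mulrN mulNr cosN.
have tE : c t = - cos (pi - pi * `|t| / 2).
  by rewrite abs cosB cospi sinpi mul0r addr0 mulN1r opprK.
rewrite abs tE subr_ge0 leNgt ltr_cos ?in_itv/= -?leNgt.
- nra.
- by apply/andP; split; nra.
- by apply/andP; split; nra.
Qed.

Lemma cosDcos_gt0 s t : `|s| + `|t| < 2 -> 0 < c s + c t.
Proof.
move=> st; have pi0 := pi_gt0 R; have := normr_ge0 s; have := normr_ge0 t => t0 s0.
have abs (x : R) : c x = cos (pi * `|x| / 2).
  by rewrite /c; case: ger0P => // _; rewrite mulrN mulNr cosN.
have tE : c t = - cos (pi - pi * `|t| / 2).
  by rewrite abs cosB cospi sinpi mul0r addr0 mulN1r opprK.
rewrite abs tE subr_gt0 ltr_cos ?in_itv/=.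
- nra.
- by apply/andP; split; nra.
- by apply/andP; split; nra.
Qed.

Lemma Dd_itv s t : -1 <= Dd s t <= 1.
Proof.
have := cos_le1 (pi * s / 2); have := cos_geN1 (pi * s / 2).
have := cos_le1 (pi * t / 2); have := cos_geN1 (pi * t / 2).
rewrite /Dd /c => *; apply/andP; split; lra.
Qed.

Lemma Dd_itvoo s t : `|s| + `|t| < 2 -> -1 < Dd s t < 1.
Proof.
move=> /cosDcos_gt0; have := cos_le1 (pi * s / 2); have := cos_geN1 (pi * s / 2).
have := cos_le1 (pi * t / 2); have := cos_geN1 (pi * t / 2).
rewrite /Dd /c => *; apply/andP; split; lra.
Qed.

Lemma p_cE s t : pi * p_c s t = - (pi * s / 4) + acos (Dd s t) / 2.
Proof.
have : pi != 0 :> R by rewrite gt_eqF ?pi_gt0.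
by rewrite /p_c /Dd /c; move: pi => P P0; field.
Qed.

Lemma p_dE s t : pi * p_d s t = pi * s / 4 + acos (Dd s t) / 2.
Proof.
have : pi != 0 :> R by rewrite gt_eqF ?pi_gt0.
by rewrite /p_d /Dd /c; move: pi => P P0; field.
Qed.

(** [c s - Dd s t] is half of [c s + c t], hence nonnegative, and so [acos (Dd s t)] is at least pi
    |s| / 2. This outweighs the linear terms and keeps the arguments of [lobachevsky] in [0, pi],
    where it is bounded. *)
Lemma p_cd_itv s t : `|s| + `|t| <= 2 ->
  0 <= pi * p_c s t <= pi /\ 0 <= pi * p_d s t <= pi.
Proof.
move=> st; have c0 := cosDcos_ge0 st; have pi0 := pi_gt0 R.
have [/andP[a0 api] aK] := acos_def (Dd_itv s t).
have := normr_ge0 s; have := normr_ge0 t => t0 s0.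
have : pi * `|s| / 2 <= acos (Dd s t).
  rewrite leNgt -ltr_cos ?in_itv/= -?leNgt ?a0 ?api//; last by apply/andP; split; nra.
  rewrite aK.
  have -> : cos (pi * `|s| / 2) = c s.
    by rewrite /c; case: ger0P => // _; rewrite mulrN mulNr cosN.
  by rewrite /Dd; lra.
have := ler_norm s; have := ler_norm (- s); rewrite normrN p_cE p_dE.
by split; apply/andP; split; nra.
Qed.

Lemma p_cd_itvoo s t : `|s| + `|t| < 2 ->
  0 < pi * p_c s t < pi /\ 0 < pi * p_d s t < pi.
Proof.
move=> st; have c0 := cosDcos_gt0 st; have pi0 := pi_gt0 R.
have [/andP[a0 api] aK] := acos_def (Dd_itv s t).
have api' : acos (Dd s t) < pi.
  by apply: acos_ltpi; have /andP[-> /ltW] := Dd_itvoo st.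
have := normr_ge0 s; have := normr_ge0 t => t0 s0.
have : pi * `|s| / 2 < acos (Dd s t).
  rewrite -ltr_cos ?in_itv/= ?a0 ?api//; last by apply/andP; split; nra.
  rewrite aK.
  have -> : cos (pi * `|s| / 2) = c s.
    by rewrite /c; case: ger0P => // _; rewrite mulrN mulNr cosN.
  by rewrite /Dd; lra.
have := ler_norm s; have := ler_norm (- s); rewrite normrN p_cE p_dE.
by split; apply/andP; split; nra.
Qed.

(* [p_a s t = p_d t s] and [p_b s t = p_c t s]. *)
Lemma entE s t : ent s t = pi^-1 * (lobachevsky (pi * p_c s t) + lobachevsky (pi * p_d s t)
   + (lobachevsky (pi * p_c t s) + lobachevsky (pi * p_d t s))).
Proof. by rewrite /ent; congr (_ * _); rewrite /p_a /p_b /p_c /p_d; ring. Qed.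

Lemma entC s t : ent s t = ent t s.
Proof. by rewrite !entE addrC. Qed.

Lemma ent_bounded : exists M : R, forall s t, `|s| + `|t| <= 2 -> `|ent s t| <= M.
Proof.
have [M HM] := lobachevsky_bounded (R := R).
exists (pi^-1 * (M + M + (M + M))) => s t st.
have [/HM c1 /HM d1] := p_cd_itv st.
have [|/HM c2 /HM d2] := @p_cd_itv t s; first by rewrite addrC.
rewrite entE normrM ger0_norm ?invr_ge0 ?pi_ge0// ler_wpM2l ?invr_ge0 ?pi_ge0//.
by do !apply: ler_norm_add2.
Qed.

(** This is the sine of [acos (Dd s t)] and also the denominator in the derivative of [acos]. *)
Let w s t := Num.sqrt (1 - Dd s t ^+ 2).

Lemma w_gt0 s t : `|s| + `|t| < 2 -> 0 < w s t.
Proof. by move=> /Dd_itvoo/andP[? ?]; rewrite sqrtr_gt0; nra. Qed.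

(** The two angles differ by [pi * s / 2] and add up to [acos (Dd s t)], so the product is half a
    difference of known cosines. Together with [sin_sum] and [sin_diff], this reduces the second
    derivatives of [ent] to algebra. *)
Lemma sin_mul_sin s t : sin (pi * p_c s t) * sin (pi * p_d s t) = (c s + c t) / 4.
Proof.
have aK := (acos_def (Dd_itv s t)).2.
have : cos (pi * p_d s t - pi * p_c s t) - cos (pi * p_d s t + pi * p_c s t) =
  (c s + c t) / 2.
  rewrite p_cE p_dE.
  have -> : pi * s / 4 + acos (Dd s t) / 2 - (- (pi * s / 4) + acos (Dd s t) / 2) =
    pi * s / 2.
    by field.
  have -> : pi * s / 4 + acos (Dd s t) / 2 + (- (pi * s / 4) + acos (Dd s t) / 2) =
    acos (Dd s t).
    by field.
  by rewrite aK /Dd /c; field.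
rewrite cosB cosD; lra.
Qed.

Lemma sin_sum s t : cos (pi * p_c s t) * sin (pi * p_d s t) +
   sin (pi * p_c s t) * cos (pi * p_d s t) = w s t.
Proof.
by rewrite addrC -sinD p_cE p_dE /w -sin_acos ?Dd_itv//; congr sin; field.
Qed.

Lemma sin_diff s t : cos (pi * p_c s t) * sin (pi * p_d s t) -
   sin (pi * p_c s t) * cos (pi * p_d s t) = sin (pi * s / 2).
Proof.
by rewrite mulrC [X in _ - X]mulrC -sinB p_cE p_dE; congr sin; field.
Qed.

Lemma is_derive_c s : is_derive s 1 c (- (pi / 2) * sin (pi * s / 2)).
Proof.
have D : is_derive s 1 (fun x => pi * x / 2) (pi / 2).
  have -> : (fun x => pi * x / 2) = (fun x : R => (pi / 2) *: (x : R)).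
    by apply/funext => x; rewrite /GRing.scale/=; field.
  by apply: is_derive_eq; rewrite /GRing.scale/= mulr1.
apply: (is_derive_eq (is_derive1_comp (is_derive_cos _) D)); ring.
Qed.

Lemma is_derive_acosD_l s t : `|s| + `|t| < 2 ->
  is_derive s 1 (fun s => acos (Dd s t)) (pi / 4 * sin (pi * s / 2) / w s t).
Proof.
move=> st.
have D : is_derive s 1 (fun s => Dd s t) (2^-1 * (- (pi / 2) * sin (pi * s / 2) - 0)).
  have -> : (fun s => Dd s t) = (fun s => 2^-1 *: (c s - cst (c t) s)).
    by apply/funext => x; rewrite /GRing.scale/= mulrC.
  apply: is_deriveZ; apply: is_deriveB; exact: is_derive_c.
have {}D := @is_derive1_comp _ acos (fun s => Dd s t) s _ _
  (is_derive1_acos (Dd_itvoo st)) D.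
apply: (is_derive_eq D).
by rewrite -/(w s t); move: pi (w_gt0 st) => P; rewrite lt0r => /andP[w0 _]; field.
Qed.

Lemma is_derive_acosD_r s t : `|s| + `|t| < 2 ->
  is_derive t 1 (fun t => acos (Dd s t)) (- (pi / 4 * sin (pi * t / 2) / w s t)).
Proof.
move=> st.
have D : is_derive t 1 (fun t => Dd s t) (2^-1 * (0 - - (pi / 2) * sin (pi * t / 2))).
  have -> : (fun t => Dd s t) = (fun t => 2^-1 *: (cst (c s) t - c t)).
    by apply/funext => x; rewrite /GRing.scale/= mulrC.
  apply: is_deriveZ; apply: is_deriveB; exact: is_derive_c.
have {}D := @is_derive1_comp _ acos (fun t => Dd s t) t _ _
  (is_derive1_acos (Dd_itvoo st)) D.
apply: (is_derive_eq D).
by rewrite -/(w s t); move: pi (w_gt0 st) => P; rewrite lt0r => /andP[w0 _]; field.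
Qed.

Lemma w_sym s t : w t s = w s t.
Proof. by rewrite /w /Dd; congr (Num.sqrt (1 - _)); field. Qed.

(** The derivative of [acos (Dd s t)] in [s]; as [Dd] is antisymmetric, the derivative in [t] is
    [- Cl t s]. *)
Let Cl s t := pi / 4 * sin (pi * s / 2) / w s t.

Lemma is_derive_linpi s : is_derive s 1 (fun s => pi * s / 4) (pi / 4).
Proof.
have -> : (fun x => pi * x / 4) = (fun x : R => (pi / 4) *: (x : R)).
  by apply/funext => x; rewrite /GRing.scale/=; field.
by apply: is_derive_eq; rewrite /GRing.scale/= mulr1.
Qed.

Lemma is_derive_p_cl s t : `|s| + `|t| < 2 ->
  is_derive s 1 (fun s => pi * p_c s t) (- (pi / 4) + 2^-1 * Cl s t).
Proof.
move=> st; have D := is_deriveD (is_deriveN (is_derive_linpi s))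
  (is_deriveZ 2^-1 (is_derive_acosD_l st)).
by under eq_fun do rewrite p_cE [X in _ + X]mulrC.
Qed.

Lemma is_derive_p_dl s t : `|s| + `|t| < 2 ->
  is_derive s 1 (fun s => pi * p_d s t) (pi / 4 + 2^-1 * Cl s t).
Proof.
move=> st; have D := is_deriveD (is_derive_linpi s)
  (is_deriveZ 2^-1 (is_derive_acosD_l st)).
by under eq_fun do rewrite p_dE [X in _ + X]mulrC.
Qed.

Lemma is_derive_p_cr s t : `|s| + `|t| < 2 ->
  is_derive t 1 (fun t => pi * p_c s t) (- (2^-1 * Cl t s)).
Proof.
move=> st; have D := is_deriveD (is_derive_cst (- (pi * s / 4)) t 1)
  (is_deriveZ 2^-1 (is_derive_acosD_r st)).
under eq_fun do rewrite p_cE [X in _ + X]mulrC.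
by apply: (is_derive_eq D); rewrite /Cl w_sym add0r scalerN.
Qed.

Lemma is_derive_p_dr s t : `|s| + `|t| < 2 ->
  is_derive t 1 (fun t => pi * p_d s t) (- (2^-1 * Cl t s)).
Proof.
move=> st; have D := is_deriveD (is_derive_cst (pi * s / 4) t 1)
  (is_deriveZ 2^-1 (is_derive_acosD_r st)).
under eq_fun do rewrite p_dE [X in _ + X]mulrC.
by apply: (is_derive_eq D); rewrite /Cl w_sym add0r scalerN.
Qed.

(** The partial derivative of [ent] in its first variable; by [entC], [ent1 t s] is the one in the
    second. *)
Definition ent1 s t := (ln (2 * sin (pi * p_c s t)) - ln (2 * sin (pi * p_d s t))) / 4.

(** The common factor of the second derivatives of [ent]: symmetric in [s] and [t], and negative on
    [ent_dom]. It is the nonzero factor between the divergence of the entropy gradient and the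
    left-hand side of the equation. *)
Let kap s t := - (pi / (8 * (c s + c t) * w s t)).

Definition ent11 s t := kap s t * (2 * (1 - Dd s t ^+ 2) - sin (pi * s / 2) ^+ 2).
Definition ent12 s t := kap s t * (sin (pi * s / 2) * sin (pi * t / 2)).

Lemma sin_pcd_gt0 s t : `|s| + `|t| < 2 -> 0 < sin (pi * p_c s t) /\ 0 < sin (pi * p_d s t).
Proof. by move=> /p_cd_itvoo[/sin_gt0_pi ? /sin_gt0_pi]. Qed.

Lemma ln_sin_sum s t : `|s| + `|t| < 2 ->
  ln (2 * sin (pi * p_c s t)) + ln (2 * sin (pi * p_d s t)) = ln (c s + c t).
Proof.
move=> st; have [s1 s2] := sin_pcd_gt0 st.
by rewrite -lnM ?posrE ?mulr_gt0//; congr ln; rewrite mulrACA sin_mul_sin; field.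
Qed.

(* The terms containing the derivative of [acos] cancel, because the product
   [sin (pi * p_c s t) * sin (pi * p_d s t)] is symmetric in [s] and [t]. *)
Lemma is_derive_ent_l s t : `|s| + `|t| < 2 ->
  is_derive s 1 (fun s => ent s t) (ent1 s t).
Proof.
move=> st; have ts : `|t| + `|s| < 2 by rewrite addrC.
have [/is_derive_lobachevsky L1 /is_derive_lobachevsky L2] := p_cd_itvoo st.
have [/is_derive_lobachevsky L3 /is_derive_lobachevsky L4] := p_cd_itvoo ts.
have D1 := is_derive1_comp (f := @lobachevsky R) (g := fun s => pi * p_c s t) L1
  (is_derive_p_cl st).
have D2 := is_derive1_comp (f := @lobachevsky R) (g := fun s => pi * p_d s t) L2
  (is_derive_p_dl st).
have D3 := is_derive1_comp (f := @lobachevsky R) (g := fun s => pi * p_c t s) L3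
  (is_derive_p_cr ts).
have D4 := is_derive1_comp (f := @lobachevsky R) (g := fun s => pi * p_d t s) L4
  (is_derive_p_dr ts).
have D := is_deriveZ pi^-1 (is_deriveD (is_deriveD D1 D2) (is_deriveD D3 D4)).
under eq_fun do rewrite entE.
apply: (is_derive_eq D); rewrite /ent1 /GRing.scale/=.
have := ln_sin_sum st; have := ln_sin_sum ts.
rewrite [c t + c s]addrC; set l1 := ln _; set l2 := ln _; set l3 := ln (2 * _);
  set l4 := ln (2 * _) => <- H.
have -> : l3 = l1 + l2 - l4 by rewrite -H; ring.
have : pi != 0 :> R by rewrite gt_eqF ?pi_gt0.
by rewrite /GRing.scale/=; move: (Cl s t) => C; move: pi => P P0; field.
Qed.

Lemma is_derive_ent_r s t : `|s| + `|t| < 2 ->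
  is_derive t 1 (fun t => ent s t) (ent1 t s).
Proof.
move=> st; under eq_fun do rewrite entC.
by apply: is_derive_ent_l; rewrite addrC.
Qed.

Lemma is_derive_ln2sin (x : R) : 0 < sin x ->
  is_derive x 1 (fun x => ln (2 * sin x)) (cos x / sin x).
Proof.
move=> x0.
have D1 := is_deriveZ 2 (is_derive_sin x).
have D2 : is_derive (2 * sin x) 1 (@ln R) (2 * sin x)^-1 by apply: is_derive1_ln;
  rewrite mulr_gt0.
have D := is_derive1_comp (f := @ln R) (g := fun x => 2 * sin x) D2 D1.
apply: (is_derive_eq D); rewrite /GRing.scale/=; field.
by rewrite gt_eqF.
Qed.

Lemma is_derive_ent1_l s t : `|s| + `|t| < 2 ->
  is_derive s 1 (fun s => ent1 s t) (ent11 s t).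
Proof.
move=> st; have [s1 s2] := sin_pcd_gt0 st.
have D1 := is_derive1_comp (f := fun x => ln (2 * sin x))
  (g := fun s => pi * p_c s t) (is_derive_ln2sin s1) (is_derive_p_cl st).
have D2 := is_derive1_comp (f := fun x => ln (2 * sin x))
  (g := fun s => pi * p_d s t) (is_derive_ln2sin s2) (is_derive_p_dl st).
have D := is_deriveZ 4^-1 (is_deriveB D1 D2).
under eq_fun do rewrite /ent1 mulrC.
apply: (is_derive_eq D); rewrite /ent11 /GRing.scale/=.
have c0 := cosDcos_gt0 st; have w0 := w_gt0 st.
have wE : 1 - Dd s t ^+ 2 = w s t ^+ 2.
  by rewrite sqr_sqrtr//; have /andP[? ?] := Dd_itvoo st; nra.
rewrite wE /kap /Cl.
(* The three identities eliminate [c s + c t], [w s t] and [sin (pi * s / 2)]. What remains is a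
   rational identity in the sines and cosines of the two angles, which holds even without the
   Pythagorean relation. *)
have := sin_mul_sin s t; have := sin_sum s t; have := sin_diff s t.
move: s1 s2 c0 w0; rewrite !lt0r => /andP[s1 _] /andP[s2 _] /andP[c0 _] /andP[w0 _].
move: (sin (pi * p_c s t)) (sin (pi * p_d s t)) (cos (pi * p_c s t))
  (cos (pi * p_d s t)) s1 s2.
move: (w s t) (c s + c t) w0 c0 => W CC W0 C0 sg sd cg cd sg0 sd0 H1 H2 H3.
move: (sin (pi * s / 2)) H1 => S <-; move: pi => P.
have -> : CC = sg * sd * 4 by rewrite H3; field.
rewrite -H2 in W0 *.
by field; rewrite W0 sg0 sd0.
Qed.

Lemma is_derive_ent1_r s t : `|s| + `|t| < 2 ->
  is_derive t 1 (fun t => ent1 s t) (ent12 s t).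
Proof.
move=> st; have [s1 s2] := sin_pcd_gt0 st.
have D1 := is_derive1_comp (f := fun x => ln (2 * sin x))
  (g := fun t => pi * p_c s t) (is_derive_ln2sin s1) (is_derive_p_cr st).
have D2 := is_derive1_comp (f := fun x => ln (2 * sin x))
  (g := fun t => pi * p_d s t) (is_derive_ln2sin s2) (is_derive_p_dr st).
have D := is_deriveZ 4^-1 (is_deriveB D1 D2).
under eq_fun do rewrite /ent1 mulrC.
apply: (is_derive_eq D); rewrite /ent12 /GRing.scale/=.
have c0 := cosDcos_gt0 st; have w0 := w_gt0 st.
rewrite /kap /Cl w_sym.
have := sin_mul_sin s t; have := sin_sum s t; have := sin_diff s t.
move: s1 s2 c0 w0; rewrite !lt0r => /andP[s1 _] /andP[s2 _] /andP[c0 _] /andP[w0 _].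
move: (sin (pi * p_c s t)) (sin (pi * p_d s t)) (cos (pi * p_c s t))
  (cos (pi * p_d s t)) s1 s2.
move: (w s t) (c s + c t) w0 c0 => W CC W0 C0 sg sd cg cd sg0 sd0 H1 H2 H3.
move: (sin (pi * s / 2)) (sin (pi * t / 2)) H1 => S T <-; move: pi => P.
have -> : CC = sg * sd * 4 by rewrite H3; field.
rewrite -H2 in W0 *.
by field; rewrite W0 sg0 sd0.
Qed.

Lemma ent12C s t : ent12 t s = ent12 s t.
Proof. by rewrite /ent12 /kap w_sym [c t + c s]addrC [X in _ * X]mulrC. Qed.

Lemma open_ent_dom : open ent_dom.
Proof.
have -> : ent_dom = (fun q : R * R => `|q.1| + `|q.2|) @^-1` [set x | x < 2] by [].
apply: open_comp; last exact: open_lt.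
move=> q _; apply: cvgD; apply: cvg_norm; [exact: cvg_fst|exact: cvg_snd].
Qed.

Lemma grad_ent : grad_on ent_dom (fun q => ent q.1 q.2)
  (fun q => ent1 q.1 q.2) (fun q => ent1 q.2 q.1).
Proof.
move=> [s t] st; split; [apply/is_derive_exP|apply/is_derive_eyP] => /=.
- exact: is_derive_ent_l.
- exact: is_derive_ent_r.
Qed.

Lemma grad_ent1 : grad_on ent_dom (fun q => ent1 q.1 q.2)
  (fun q => ent11 q.1 q.2) (fun q => ent12 q.1 q.2).
Proof.
move=> [s t] st; split; [apply/is_derive_exP|apply/is_derive_eyP] => /=.
- exact: is_derive_ent1_l.
- exact: is_derive_ent1_r.
Qed.

Lemma grad_ent2 : grad_on ent_dom (fun q => ent1 q.2 q.1)
  (fun q => ent12 q.1 q.2) (fun q => ent11 q.2 q.1).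
Proof.
move=> [s t] st; split; [apply/is_derive_exP|apply/is_derive_eyP] => /=.
- by rewrite -ent12C; apply: is_derive_ent1_r; rewrite addrC.
- by apply: is_derive_ent1_l; rewrite addrC.
Qed.

Let cvg_c (h : R * R -> R) (P : R * R) : {for P, continuous h} ->
  {for P, continuous (fun q => c (h q))}.
Proof.
move=> hP; apply: (@continuous_comp _ _ _ h c) => //.
by apply/differentiable_continuous/derivable1_diffP; case: (is_derive_c (h P)).
Qed.

Let cvg_s (h : R * R -> R) (P : R * R) : {for P, continuous h} ->
  {for P, continuous (fun q => sin (pi * h q / 2))}.
Proof.
move=> hP; apply: (@continuous_comp _ _ _ (fun q => pi * h q / 2) sin).
  by apply: cvgM; [apply: cvgM => //; exact: cvg_cst|exact: cvg_cst].
exact: continuous_sin.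
Qed.

Let cvg_Dd P : {for P, continuous (fun q : R * R => Dd q.1 q.2)}.
Proof.
apply: cvgM; last exact: cvg_cst.
by apply: cvgB; apply: cvg_c; [exact: cvg_fst|exact: cvg_snd].
Qed.

Let cvg_kap P : ent_dom P -> {for P, continuous (fun q : R * R => kap q.1 q.2)}.
Proof.
move=> dP; apply: cvgN; apply: cvgM; first exact: cvg_cst.
apply: cvgV; first by rewrite !mulf_neq0// gt_eqF// ?cosDcos_gt0 ?w_gt0.
apply: cvgM; first apply: cvgM; first exact: cvg_cst.
  by apply: cvgD; apply: cvg_c; [exact: cvg_fst|exact: cvg_snd].
apply: (@continuous_comp _ _ _ (fun q : R * R => 1 - Dd q.1 q.2 ^+ 2) Num.sqrt);
  last exact: sqrt_continuous.
apply: cvgB; first exact: cvg_cst.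
by apply: cvgM; exact: cvg_Dd.
Qed.

Lemma continuous_ent11 P : ent_dom P ->
  {for P, continuous (fun q : R * R => ent11 q.1 q.2)}.
Proof.
move=> dP; apply: cvgM; first exact: cvg_kap.
have sP : {for P, continuous (fun q : R * R => sin (pi * q.1 / 2))}.
  by apply: cvg_s; exact: cvg_fst.
apply: cvgB; last exact: cvgM.
apply: cvgM; first exact: cvg_cst.
apply: cvgB; first exact: cvg_cst.
by apply: cvgM; exact: cvg_Dd.
Qed.

Lemma continuous_ent12 P : ent_dom P ->
  {for P, continuous (fun q : R * R => ent12 q.1 q.2)}.
Proof.
move=> dP; apply: cvgM; first exact: cvg_kap.
by apply: cvgM; apply: cvg_s; [exact: cvg_fst|exact: cvg_snd].
Qed.

Lemma continuous_ent22 P : ent_dom P ->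
  {for P, continuous (fun q : R * R => ent11 q.2 q.1)}.
Proof.
move=> dP.
have E : (fun q : R * R => ent11 q.2 q.1) = (fun q : R * R => kap q.1 q.2 *
    (2 * (1 - Dd q.1 q.2 ^+ 2) - sin (pi * q.2 / 2) ^+ 2)).
  apply/funext => q; rewrite /ent11 /kap w_sym [c _ + _]addrC;
    congr (_ * (2 * (1 - _) - _)).
  by rewrite /Dd; field.
rewrite E; apply: cvgM; first exact: cvg_kap.
have sP : {for P, continuous (fun q : R * R => sin (pi * q.2 / 2))}.
  by apply: cvg_s; exact: cvg_snd.
apply: cvgB; last exact: cvgM.
apply: cvgM; first exact: cvg_cst.
apply: cvgB; first exact: cvg_cst.
by apply: cvgM; exact: cvg_Dd.
Qed.

(** All the coefficients contain the same nonzero [kap s t], which cancels; the two mixed terms add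
    up to the coefficient 2. *)
Lemma euler_lagrange_coef s t (fxx fxy fyy : R) : `|s| + `|t| < 2 ->
  ent11 s t * fxx + ent12 s t * fxy + (ent12 s t * fxy + ent11 t s * fyy) = 0 ->
  let D := (cos (pi * s / 2) - cos (pi * t / 2)) / 2 in
  (2 * (1 - D ^+ 2) - sin (pi * s / 2) ^+ 2) * fxx
  + 2 * sin (pi * s / 2) * sin (pi * t / 2) * fxy
  + (2 * (1 - D ^+ 2) - sin (pi * t / 2) ^+ 2) * fyy = 0.
Proof.
move=> st H D.
have k0 : kap s t != 0.
  by rewrite /kap oppr_eq0 mulf_neq0 ?invr_eq0 ?mulf_neq0// gt_eqF ?pi_gt0
    ?cosDcos_gt0 ?w_gt0.
apply: (mulfI k0); rewrite mulr0 -H /ent11 /ent12.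
have -> : kap t s = kap s t by rewrite /kap w_sym [c _ + _]addrC.
have -> : Dd t s ^+ 2 = Dd s t ^+ 2 by rewrite /Dd; field.
rewrite /D -/(c s) -/(c t) -/(Dd s t).
by move: (kap s t) (Dd s t) (sin _) (sin _) => k0' d S T; ring.
Qed.

End Entropy.

(** * Integrals of non-measurable and of planar functions *)

Section LowerIntegral.
Context d (T : measurableType d) {R : realType} (mu : {measure set T -> \bar R}).
Import HBNNSimple.
Local Open Scope ereal_scope.

(* The library defines the integral of any nonnegative function as a supremum over
   the simple functions below it; working with this lower integral avoids proving
   that the partial derivatives of a Lipschitz function are measurable. *)
Lemma ge0_le_integral_nonmeas (D : set T) (f1 f2 : T -> \bar R) :
  (forall x, D x -> 0 <= f1 x) -> (forall x, D x -> f1 x <= f2 x) ->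
  \int[mu]_(x in D) f1 x <= \int[mu]_(x in D) f2 x.
Proof.
move=> f10 f12; have f20 x : D x -> 0 <= f2 x by move=> Dx;
  exact: le_trans (f10 x Dx) (f12 x Dx).
rewrite !ge0_integralE//; apply: ereal_sup_le => _ [h hf <-]; exists h => // x.
apply: le_trans (hf x) _; rewrite /patch; case: ifPn => //; rewrite inE; exact: f12.
Qed.

(** A simple function below [f] splits along the measurable set [S], which gives one inequality. For
    the other, simple functions below the two restrictions add up to a simple function below [f].
    Measurability of [f] never enters. *)
Lemma ge0_integral_split (D S : set T) (f : T -> \bar R) : measurable S ->
  (forall x, D x -> 0 <= f x) ->
  \int[mu]_(x in D) f x = \int[mu]_(x in D `&` S) f x + \int[mu]_(x in D `&` ~` S) f x.
Proof.
move=> mS f0; have mCS : measurable (~` S) by exact: measurableC.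
have g0 (A : set T) x : 0 <= (f \_ (D `&` A)) x.
  by rewrite /patch; case: ifPn => //; rewrite inE => -[/f0].
have f0' A x : (D `&` A) x -> 0 <= f x by move=> [/f0].
apply/eqP; rewrite eq_le; apply/andP; split.
  rewrite ge0_integralE//; apply: ge_ereal_sup => _ [h hf <-].
  have hx (A : set T) : \int[mu]_(x in A) (h x)%:E <= \int[mu]_(x in D `&` A) f x.
    rewrite integral_mkcondl; apply: ge0_le_integral_nonmeas => x Ax.
      by rewrite lee_fin; exact: fun_ge0.
    exact: hf.
  apply: le_trans (leeD (hx S) (hx (~` S))).
  rewrite -ge0_integral_setU//=; last 2 first.
  - by move=> x _; rewrite lee_fin; exact: fun_ge0.
  - by apply/disj_set2P; rewrite setICr.
  - by rewrite setUCr integral_nnsfun// patch_setT.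
  - by apply/measurable_EFinP; exact: measurable_funTS.
have key : forall h1 h2 : {nnsfun T >-> R},
    (forall x, (h1 x)%:E <= (f \_ (D `&` S)) x) ->
    (forall x, (h2 x)%:E <= (f \_ (D `&` ~` S)) x) ->
    sintegral mu h1 + sintegral mu h2 <= \int[mu]_(x in D) f x.
  move=> h1 h2 hf1 hf2; rewrite -sintegralD ge0_integralE//.
  apply: ereal_sup_ubound; exists (add_nnsfun h1 h2) => //= x.
  rewrite EFinD; apply: le_trans (leeD (hf1 x) (hf2 x)) _.
  rewrite /patch !in_setI in_setC; case: (x \in D); case: (x \in S);
    rewrite /= ?addr0 ?add0r ?adde0 ?add0e//.
(* An infinite integral over [D] settles the claim. A finite one makes all terms finite, so [key]
   can be solved for one simple integral at a time and the two suprema taken in succession. *)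
case: (ltP (\int[mu]_(x in D) f x) +oo) => [Cfin|]; last first.
  by rewrite leye_eq => /eqP ->; exact: leey.
have leC A : \int[mu]_(x in D `&` A) f x <= \int[mu]_(x in D) f x.
  rewrite integral_mkcondr; apply: ge0_le_integral_nonmeas => x Dx; rewrite /patch;
    case: ifP => // _; exact: f0.
have fin A : \int[mu]_(x in D `&` A) f x \is a fin_num.
  rewrite ge0_fin_numE; first exact: le_lt_trans (leC A) _.
  by apply: integral_ge0; exact: f0'.
have Cf : \int[mu]_(x in D) f x \is a fin_num by rewrite ge0_fin_numE ?integral_ge0.
rewrite -leeBrDr//.
rewrite [X in X <= _]ge0_integralE; last by move=> x []; auto.
apply: ge_ereal_sup => _ [h1 hf1 <-].
have h1fin : sintegral mu h1 \is a fin_num.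
  rewrite ge0_fin_numE ?sintegral_ge0//; apply: le_lt_trans Cfin.
  have := key h1 nnsfun0 hf1; rewrite sintegral0 adde0; apply.
  by move=> x; exact: g0.
rewrite leeBrDr// -leeBrDl//.
rewrite [X in X <= _]ge0_integralE; last by move=> x []; auto.
apply: ge_ereal_sup => _ [h2 hf2 <-].
by rewrite leeBrDl//; exact: key.
Qed.

(** The nonnegative case is applied to the positive and the negative part; the bound and the finite
    measure exclude a difference of infinities. *)
Lemma bounded_integral_split (D S : set T) (M : R) (F : T -> R) : measurable D ->
  measurable S ->
  mu D < +oo -> (forall x, D x -> `|F x| <= M)%R ->
  (\int[mu]_(x in D) F x = \int[mu]_(x in D `&` S) F x + \int[mu]_(x in D `&` ~` S) F x)%R.
Proof.
move=> mD mS Dfin FM.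
have fin (G : T -> \bar R) A : (forall x, D x -> 0 <= G x <= M%:E) ->
    \int[mu]_(x in D `&` A) G x \is a fin_num.
  move=> GM; rewrite ge0_fin_numE; last first.
    by apply: integral_ge0 => x [/GM/andP[]].
  apply: (@le_lt_trans _ _ (\int[mu]_(x in D) cst M%:E x)).
    rewrite integral_mkcondr; apply: ge0_le_integral_nonmeas => x /GM /andP[G0 Gm];
      by rewrite /patch; case: ifP => //= _; exact: le_trans G0 Gm.
  (* A point of [D] is what shows that [M] is nonnegative; the empty set is treated apart. *)
  rewrite integral_cst//; case: (pselect (exists x, D x)) => [[x Dx]|D0].
    apply: lte_mul_pinfty => //; rewrite lee_fin.
    exact: le_trans (normr_ge0 _) (FM x Dx).
  have -> : D = set0 by rewrite -subset0 => x Dx; apply: D0; exists x.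
  by rewrite measure0 mule0.
have Fp x : D x -> 0 <= (EFin \o F)^\+ x <= M%:E.
  move=> /FM; rewrite ler_norml => /andP[FM1 FM2].
  rewrite funepos_ge0/= funeposE ge_max !lee_fin FM2/=.
  by move: FM1 FM2; lra.
have Fn x : D x -> 0 <= (EFin \o F)^\- x <= M%:E.
  move=> /FM; rewrite ler_norml => /andP[FM1 FM2].
  rewrite funeneg_ge0/= funenegE ge_max !lee_fin lerNl FM1/=.
  by move: FM1 FM2; lra.
rewrite /Rintegral -fineD.
- congr fine; rewrite integralE [X in _ = X + _]integralE [X in _ = _ + X]integralE.
  rewrite (ge0_integral_split mS (fun x Dx => proj1 (andP (Fp x Dx)))).
  rewrite (ge0_integral_split mS (fun x Dx => proj1 (andP (Fn x Dx)))).
  by rewrite oppeD ?fin_num_adde_defl ?fin// addeACA.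
- by rewrite integralE fin_numB !fin.
- by rewrite integralE fin_numB !fin.
Qed.

End LowerIntegral.

(** * Measurability of open sets and of continuous functions in the plane *)

Section PlaneMeasure.
Context {R : realType}.
Notation mu := (@lebesgue_measure R).
Notation mu2 := (mu \x mu)%E.

Lemma ball_prodE (p : R * R) r :
  ball p r = `]p.1 - r, p.1 + r[%classic `*` `]p.2 - r, p.2 + r[%classic.
Proof.
rewrite eqEsubset; split=> q; rewrite /= !in_itv/= /ball/= /prod_ball/ball/=;
  by rewrite ![`|p.1 - _|]distrC ![`|p.2 - _|]distrC !ltr_distl.
Qed.

Lemma measurable_ball2 (p : R * R) r : measurable (ball p r).
Proof. by rewrite ball_prodE; apply: measurableX; exact: measurable_itv. Qed.

Lemma mu2_ball (p : R * R) r : 0 < r -> mu2 (ball p r) = ((2 * r) ^+ 2)%:E.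
Proof.
move=> r0; rewrite ball_prodE.
rewrite product_measure1E ?measurable_itv//= !lebesgue_measure_itv/= !lte_fin
  !ltrBlDr -!addrA !ltrDl !addr_gt0//.
by rewrite -!EFinB -EFinM; congr (_%:E); ring.
Qed.

Lemma open_measurable2 (U : set (R * R)) : open U -> measurable U.
Proof.
move=> oU.
pose F (i : rat * rat * rat) : set (R * R) :=
  if `[< ball (ratr i.1.1 : R, ratr i.1.2 : R) (ratr i.2) `<=` U >]
  then ball (ratr i.1.1 : R, ratr i.1.2 : R) (ratr i.2) else set0.
have -> : U = \bigcup_i F i.
  rewrite eqEsubset; split => q; last first.
    by move=> [i _]; rewrite /F; case: ifPn => // /asboolP; apply.
  move=> Uq; have /nbhs_ballP[e /= e0 eU] : nbhs q U by exact: open_nbhs_nbhs.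
  (* With a rational centre within [e / 4] of [q] and a rational radius between [e / 4] and [e / 2],
     the square contains [q] and stays within [e] of it. *)
  have e42 : e / 4 < e / 2 by lra.
  have [r] := rat_in_itvoo e42.
  rewrite in_itv/= => /andP[r1 r2].
  have app (x : R) : exists a : rat, `|ratr a - x| < e / 4.
    have xe : x - e / 4 < x + e / 4 by lra.
    have [a] := rat_in_itvoo xe.
    by rewrite in_itv/= -ltr_distl => ?; exists a.
  have [a ax] := app q.1; have [b bx] := app q.2.
  exists (a, b, r) => //; rewrite /F ifT.
    by split; [exact: lt_trans ax r1|exact: lt_trans bx r1].
  apply/asboolP => z [z1 z2]; apply: eU.
  have tri (u v w : R) : `|v - u| < e / 4 -> `|v - w| < ratr r -> `|u - w| < e.
    by move=> vu vw; apply: le_lt_trans (ler_distD v _ _) _; rewrite distrC; lra.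
  by split; [exact: tri ax z1|exact: tri bx z2].
apply: countable_bigcupT_measurable => // i.
by rewrite /F; case: ifP => // _; exact: measurable_ball2.
Qed.

Lemma continuous_measurable2 (D : set (R * R)) (F : R * R -> R) : open D ->
  (forall q, D q -> {for q, continuous F}) -> measurable_fun D F.
Proof.
move=> oD cF; apply: (measurability _ (RGenOpens.measurableE R)).
move=> _ [_ [a [b ->] <-]].
apply: open_measurable2; rewrite openE => q [Dq Vq].
apply: filterI; first exact: open_nbhs_nbhs.
by apply: (cF q Dq); apply: open_nbhs_nbhs; split => //; exact: interval_open.
Qed.

End PlaneMeasure.

(** * Integrals of products over squares *)

Section ProductIntegrals.
Context {R : realType}.
Notation mu := (@lebesgue_measure R).
Notation mu2 := (mu \x mu)%E.

Lemma continuous_bounded_itvcc (g : R -> R) a b : a <= b -> continuous g ->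
  exists M, forall x, a <= x <= b -> `|g x| <= M.
Proof.
move=> ab cg; have [|c _ H] := @EVT_max R (fun x => `|g x|) a b ab.
  by apply: continuous_subspaceT => x; apply: cvg_norm; exact: cg.
by exists `|g c| => x xab; apply: H; rewrite in_itv.
Qed.

Lemma bounded_integrable_ball (F : R * R -> R) p r M : 0 < r ->
  (forall q, ball p r q -> {for q, continuous F}) ->
  (forall q, ball p r q -> `|F q| <= M) ->
  mu2.-integrable (ball p r) (EFin \o F).
Proof.
move=> r0 cF FM; apply: measurable_bounded_integrable.
- exact: measurable_ball2.
- by rewrite (_ : _ (ball p r) = ((2 * r) ^+ 2)%:E) ?ltry//; exact: mu2_ball.
- by apply: continuous_measurable2 => //; exact: ball_open.
- by exists M; split; [exact: num_real|move=> N /ltW MN q /FM/le_trans; exact].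
Qed.

Lemma continuous_prod_fst (g k : R -> R) q : continuous g -> continuous k ->
  {for q, continuous (fun q : R * R => g q.1 * k q.2)}.
Proof.
move=> cg ck; apply: cvgM.
  by apply: (@continuous_comp _ _ _ fst g); [exact: cvg_fst|exact: cg].
by apply: (@continuous_comp _ _ _ snd k); [exact: cvg_snd|exact: ck].
Qed.

Lemma integrable_ball_prod (g k : R -> R) p r : 0 < r -> continuous g -> continuous k ->
  mu2.-integrable (ball p r) (EFin \o (fun q : R * R => g q.1 * k q.2)).
Proof.
move=> r0 cg ck.
have le (c : R) : c - r <= c + r by lra.
have [M gM] := continuous_bounded_itvcc (le p.1) cg.
have [N kN] := continuous_bounded_itvcc (le p.2) ck.
apply: (@bounded_integrable_ball _ _ _ (M * N)) => // q.
  by move=> _; exact: continuous_prod_fst.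
rewrite ball_prodE => -[/=]; rewrite !in_itv/= => /andP[/ltW a1 /ltW b1]
  /andP[/ltW a2 /ltW b2].
by rewrite normrM ler_pM// ?gM ?kN//; apply/andP.
Qed.

(** The ball is a product of two intervals, so the extension of the integrand by zero is again a
    product, and Fubini separates the variables. *)
Lemma Rintegral_ball_prod (g k : R -> R) p r : 0 < r -> continuous g -> continuous k ->
  \int[mu2]_(q in ball p r) (g q.1 * k q.2) =
  (\int[mu]_(x in `]p.1 - r, p.1 + r[) g x) * (\int[mu]_(y in `]p.2 - r, p.2 + r[) k y).
Proof.
move=> r0 cg ck.
have igk := integrable_ball_prod p r0 cg ck.
set I := `]p.1 - r, p.1 + r[%classic; set J := `]p.2 - r, p.2 + r[%classic.
have i1 (h : R -> R) (c : R) : continuous h -> mu.-integrable `]c - r, c + r[ (EFin \o h).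
  move=> ch; have ih : mu.-integrable `[c - r, c + r] (EFin \o h).
    apply: continuous_compact_integrable; first exact: segment_compact.
    exact: continuous_subspaceT.
  apply: integrableS ih => //; try exact: measurable_itv.
  by move=> x; rewrite /= !in_itv/= => /andP[/ltW -> /ltW ->].
set K := \int[mu]_(y in J) k y.
have kK : (\int[mu]_(y in J) (k y)%:E)%E = K%:E.
  rewrite /K /Rintegral fineK//; apply: integrable_fin_num; first exact: measurable_itv.
  exact: i1.
rewrite /Rintegral integral_mkcond -integral12_prod_meas1; last first.
  refine ((integrable_mkcond _ _).1 _); [exact: measurable_ball2|exact: igk].
transitivity (\int[mu]_x ((g \_ I) x * K)).
  congr fine; apply: eq_integral => x _; rewrite /fubini_F/=.
  rewrite (_ : (fun y => _) = (fun y => ((g \_ I) x)%:E * ((EFin \o k) \_ J) y)%E);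
    last first.
    apply/funext => y; rewrite /patch ball_prodE in_setX -/I -/J.
    by case: (x \in I); case: (y \in J); rewrite /= ?mul0e ?mule0 ?EFinM.
  rewrite integralZl//; last by refine ((integrable_mkcond _ _).1 _);
    [exact: measurable_itv|exact: i1].
  by rewrite -integral_mkcond kK EFinM.
rewrite RintegralZr//.
  by rewrite -Rintegral_mkcond.
rewrite -restrict_EFin; by refine ((integrable_mkcond _ _).1 _);
  [exact: measurable_itv|exact: i1].
Qed.

Definition quart (A B C D E u : R) := A + B * u + C * u ^+ 2 + D * u ^+ 3 + E * u ^+ 4.

Lemma continuous_quart A B C D E c : continuous (fun x => quart A B C D E (x - c)).
Proof.
move=> x; rewrite /quart.
have cx n : {for x, continuous (fun x : R => (x - c) ^+ n)}.
  apply: (@continuous_comp _ _ _ (fun x : R => x - c) (fun u : R => u ^+ n)).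
    by apply: cvgB; [exact: cvg_id|exact: cvg_cst].
  exact: exprn_continuous.
have cM a n : {for x, continuous (fun x : R => a * (x - c) ^+ n)}.
  by apply: cvgM; [exact: cvg_cst|exact: cx].
apply: cvgD; last exact: cM; apply: cvgD; last exact: cM.
by apply: cvgD; last exact: cM; apply: cvgD; [exact: cvg_cst|exact: (cM B 1%N)].
Qed.

(** Odd powers of [x - c] cancel over the symmetric interval; this parity removes the unwanted terms
    of the first variation. *)
Lemma Rintegral_quart A B C D E c r : 0 < r ->
  \int[mu]_(x in `]c - r, c + r[) quart A B C D E (x - c) =
  2 * (A * r + C * r ^+ 3 / 3 + E * r ^+ 5 / 5).
Proof.
move=> r0; have cr : c - r < c + r by lra.
pose F x := quart 0 A (B / 2) (C / 3) (D / 4) (x - c) + E / 5 * (x - c) ^+ 5.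
have DX (n : nat) (x : R) : is_derive x 1 (fun x : R => (x - c) ^+ n.+1)
  (n.+1%:R * (x - c) ^+ n).
  have D1 : is_derive x 1 (fun x : R => x - c) (1 - 0) by exact: is_deriveB.
  have D2 := is_deriveX n.+1 D1.
  have E1 : (fun x : R => x - c) ^+ n.+1 = (fun x => (x - c) ^+ n.+1).
    by rewrite exprfctE.
  rewrite E1 in D2; apply: (is_derive_eq D2).
  by rewrite subr0 /GRing.scale/= mulr1 mulr_natl.
have DF (x : R) : is_derive x 1 F (quart A B C D E (x - c)).
  have DZ a n := is_deriveZ a (DX n x).
  have D' := is_deriveD (is_deriveD
    (is_deriveD (is_deriveD (is_derive_cst 0 x 1) (DZ A 0%N)) (DZ (B/2) 1%N))
     (DZ (C/3) 2%N)) (is_deriveD (DZ (D/4) 3%N) (DZ (E/5) 4%N)).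
  have -> : F = (fun x => 0 + A * (x - c) ^+ 1 + B / 2 * (x - c) ^+ 2 + C / 3 *
    (x - c) ^+ 3 + (D / 4 * (x - c) ^+ 4 + E / 5 * (x - c) ^+ 5)).
    by apply/funext => y; rewrite /F /quart; ring.
  by apply: (is_derive_eq D'); rewrite /GRing.scale/= /quart; field.
have cF (z : R) : {for z, continuous F}.
  by apply/differentiable_continuous/derivable1_diffP; case: (DF z).
have ig : measurable_fun `]c - r, c + r[ (EFin \o (fun x => quart A B C D E (x - c))).
  apply/measurable_EFinP; apply: measurable_funTS.
  by apply: continuous_measurable_fun; exact: continuous_quart.
rewrite /Rintegral -(integral_itv_bndoo true false ig) (@continuous_FTC2 _ _ F)//.
- by rewrite -EFinB /= /F /quart; field.
- exact/continuous_subspaceT/continuous_quart.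
- split; first by move=> x _; case: (DF x).
    by apply: cvg_at_right_filter; exact: cF.
  by apply: cvg_at_left_filter; exact: cF.
- by move=> x _; rewrite derive1E; case: (DF x).
Qed.

End ProductIntegrals.

(** * Competitors *)

Section Bump.
Context {R : realType}.
Implicit Types (g : R * R -> R) (p q : R * R) (r u : R).

(** The form that suits the square of [Num.max w 0]: a quadratic remainder bound treats the kink at
    0 like any other point. *)
Lemma is_derive_quadratic_bound (f : R -> R) (x d : R) :
  (forall h, `|f (h + x) - f x - d * h| <= h ^+ 2) -> is_derive x 1 f d.
Proof.
move=> H.
have C : h^-1 *: ((f \o shift x) (h *: (1 : R)) - f x) @[h --> (0 : R)^'] --> d.
  apply/cvgrPdist_lt => e e0; near=> h.
  have h0 : h != 0 by near: h; exact: nbhs_dnbhs_neq.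
  have he : `|h| < e by near: h; apply: dnbhs0_lt.
  rewrite /= /GRing.scale/= mulr1 distrC.
  rewrite (_ : _ - d = h^-1 * (f (h + x) - f x - d * h)); last by field.
  rewrite normrM normfV mulrC ltr_pdivrMr ?normr_gt0//.
  apply: le_lt_trans (H h) _.
  by rewrite -real_normK ?num_real// expr2 ltr_pM2r ?normr_gt0.
by split; [apply/cvg_ex; exists d|exact: cvg_lim].
Unshelve. all: by end_near. Qed.

(** Squaring the truncated parabola makes it continuously differentiable across the ends of its
    support, while it remains a polynomial inside. *)
Definition bump r u := Num.max (r ^+ 2 - u ^+ 2) 0 ^+ 2.
Definition dbump r u := - 4 * u * Num.max (r ^+ 2 - u ^+ 2) 0.

Lemma is_derive_bump r u : is_derive u 1 (bump r) (dbump r u).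
Proof.
have D1 : is_derive (r ^+ 2 - u ^+ 2) 1 (fun w => Num.max w 0 ^+ 2)
  (2 * Num.max (r ^+ 2 - u ^+ 2) 0).
  apply: is_derive_quadratic_bound => h; set w := r ^+ 2 - u ^+ 2.
  have [hw|hw] := leP (h + w) 0; have [w0|w0] := leP w 0; rewrite ler_norml;
    apply/andP; split; nra.
have D2 : is_derive u 1 (fun u => r ^+ 2 - u ^+ 2) (0 - 2 * u).
  have E : (fun u => r ^+ 2 - u ^+ 2) = (cst (r ^+ 2) - (@id R) ^+ 2).
    by apply/funext => x; rewrite exprfctE.
  rewrite E; apply: is_deriveB; apply: is_derive_eq.
  by rewrite /GRing.scale/= expr1 mulr1 mulr_natl.
have D := @is_derive1_comp _ (fun w => Num.max w 0 ^+ 2) (fun u => r ^+ 2 - u ^+ 2)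
  u _ _ D1 D2.
by apply: (is_derive_eq D); rewrite /dbump; ring.
Qed.

Lemma continuous_dbump r : continuous (dbump r).
Proof.
move=> u; apply: cvgM; first by apply: cvgM; [exact: cvg_cst|exact: cvg_id].
apply: (@continuous_comp _ _ _ (fun u : R => r ^+ 2 - u ^+ 2) (fun w : R => Num.max w 0)).
  by apply: cvgB; [exact: cvg_cst|exact: exprn_continuous].
by apply: continuous_max; [exact: cvg_id|exact: cvg_cst].
Qed.

Lemma continuous_bump r : continuous (bump r).
Proof.
by move=> u; apply/differentiable_continuous/derivable1_diffP; case: (is_derive_bump r u).
Qed.

Lemma bump_out r u : 0 <= r -> r <= `|u| -> bump r u = 0 /\ dbump r u = 0.
Proof.
move=> r0 ru; rewrite /bump /dbump max_r ?expr0n/= ?mulr0//.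
by rewrite subr_le0 -(real_normK (num_real u)) lerXn2r ?nnegrE.
Qed.

Lemma bump_in r u : `|u| < r -> bump r u = (r ^+ 2 - u ^+ 2) ^+ 2 /\
  dbump r u = - 4 * u * (r ^+ 2 - u ^+ 2).
Proof.
move=> ur; have r0 : 0 <= r by apply: le_trans (ltW ur).
rewrite /bump /dbump max_l// subr_ge0 -(real_normK (num_real u)) lerXn2r ?nnegrE//.
exact: ltW.
Qed.

Lemma bump_bounds r u : 0 < r -> `|bump r u| <= r ^+ 4 /\ `|dbump r u| <= 4 * r ^+ 3.
Proof.
move=> r0; have [ur|ru] := ltP `|u| r; last first.
  have [-> ->] := bump_out (ltW r0) ru; rewrite normr0; split.
    by rewrite exprn_ge0// ltW.
  by rewrite mulr_ge0// exprn_ge0// ltW.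
have [-> ->] := bump_in ur.
have u2 : u ^+ 2 <= r ^+ 2 by rewrite -(real_normK (num_real u)) lerXn2r ?nnegrE// ltW.
have m0 : 0 <= r ^+ 2 - u ^+ 2 by rewrite subr_ge0.
have m1 : r ^+ 2 - u ^+ 2 <= r ^+ 2 by rewrite lerBlDr lerDl sqr_ge0.
split.
  by rewrite ger0_norm ?exprn_ge0// (_ : r ^+ 4 = (r ^+ 2) ^+ 2) ?lerXn2r ?nnegrE
    ?sqr_ge0// -exprM.
rewrite normrM (ger0_norm m0) normrM normrN (ger0_norm (_ : 0 <= 4))//.
rewrite -mulrA ler_wpM2l// (_ : r ^+ 3 = r * r ^+ 2); last by ring.
by rewrite ler_pM// ltW.
Qed.

Definition bump2 p r q := bump r (q.1 - p.1) * bump r (q.2 - p.2).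
Definition bump2x p r q := dbump r (q.1 - p.1) * bump r (q.2 - p.2).
Definition bump2y p r q := bump r (q.1 - p.1) * dbump r (q.2 - p.2).

Let is_derive_bump_shift r (c x : R) : is_derive x 1 (fun x => bump r (x - c))
  (dbump r (x - c)).
Proof.
have D1 : is_derive x 1 (fun x : R => x - c) (1 - 0) by exact: is_deriveB.
have D := @is_derive1_comp _ (bump r) (fun x => x - c) x _ _ (is_derive_bump r (x - c)) D1.
by apply: (is_derive_eq D); rewrite subr0 mulr1.
Qed.

Lemma grad_bump2 p r : grad_on setT (bump2 p r) (bump2x p r) (bump2y p r).
Proof.
move=> q _; split; [apply/is_derive_exP|apply/is_derive_eyP]; rewrite /bump2 /=.
  under eq_fun do rewrite mulrC.
  have D := is_deriveZ (bump r (q.2 - p.2)) (is_derive_bump_shift r p.1 q.1).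
  by apply: (is_derive_eq D); rewrite /bump2x mulrC.
exact: (is_deriveZ (bump r (q.1 - p.1)) (is_derive_bump_shift r p.2 q.2)).
Qed.

Let continuous_shift (k : R -> R) (c : R) : continuous k -> continuous (fun x => k (x - c)).
Proof.
move=> ck x; apply: (@continuous_comp _ _ _ (fun x : R => x - c) k).
  by apply: cvgB; [exact: cvg_id|exact: cvg_cst].
exact: ck.
Qed.

Let continuous_mul2 (k l : R -> R) p q : continuous k -> continuous l ->
  {for q, continuous (fun q : R * R => k (q.1 - p.1) * l (q.2 - p.2))}.
Proof.
move=> ck cl; apply: cvgM.
  apply: (@continuous_comp _ _ _ fst (fun x => k (x - p.1))); first exact: cvg_fst.
  exact: continuous_shift.
apply: (@continuous_comp _ _ _ snd (fun x => l (x - p.2))); first exact: cvg_snd.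
exact: continuous_shift.
Qed.

Lemma continuous_bump2x p r q : {for q, continuous (bump2x p r)}.
Proof. exact: continuous_mul2 (@continuous_dbump r) (@continuous_bump r). Qed.

Lemma continuous_bump2y p r q : {for q, continuous (bump2y p r)}.
Proof. exact: continuous_mul2 (@continuous_bump r) (@continuous_dbump r). Qed.

Lemma bump2_out p r q : 0 < r -> ~ ball p r q ->
  [/\ bump2 p r q = 0, bump2x p r q = 0 & bump2y p r q = 0].
Proof.
move=> r0 nb; rewrite /bump2 /bump2x /bump2y.
have [b1|b1] := ltP `|q.1 - p.1| r; last first.
  by have [-> ->] := bump_out (ltW r0) b1; rewrite !mul0r.
have [b2|b2] := ltP `|q.2 - p.2| r; last first.
  by have [-> ->] := bump_out (ltW r0) b2; rewrite !mulr0.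
by exfalso; apply: nb; split; rewrite /ball/= distrC.
Qed.

Lemma bump2_bounds p r q : 0 < r ->
  `|bump2x p r q| <= 4 * r ^+ 7 /\ `|bump2y p r q| <= 4 * r ^+ 7.
Proof.
move=> r0; have [a1 a2] := bump_bounds (q.1 - p.1) r0.
have [b1 b2] := bump_bounds (q.2 - p.2) r0.
rewrite /bump2x /bump2y (normrM (dbump _ _) (bump _ _)) (normrM (bump _ _) (dbump _ _)).
split.
  have -> : 4 * r ^+ 7 = (4 * r ^+ 3) * r ^+ 4 by ring.
  by rewrite ler_pM.
have -> : 4 * r ^+ 7 = r ^+ 4 * (4 * r ^+ 3) by ring.
by rewrite ler_pM.
Qed.

End Bump.

(** * The slope bound for 2-Lipschitz functions *)

Section Slope.
Context {R : realType}.

(* At a point of non-derivability ['D_1 f x] is 0 and [k = 0] works. *)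
Lemma derive_increment (f : R -> R) (x e : R) : 0 < e -> exists2 d : R, 0 < d &
  forall h : R, 0 < h < d ->
    (exists2 k, `|k| <= h & (`|'D_1 f x| - e) * h <= f (k + x) - f x) /\
    (exists2 k, `|k| <= h & f (k + x) - f x <= - ((`|'D_1 f x| - e) * h)).
Proof.
move=> e0; have [df|ndf] := pselect (derivable f x 1); last first.
  have D0 : 'D_1 f x = 0 by rewrite /derive; exact: dvgP.
  exists 1 => // h /andP[h0 _]; rewrite D0 normr0 sub0r mulNr opprK.
  by split; exists 0; rewrite ?normr0 ?(ltW h0)// add0r subrr ?oppr_le0 mulr_ge0// ltW.
have /cvgrPdist_lt/(_ e e0) : h^-1 *: ((f \o shift x) (h *: (1 : R)) - f x)
  @[h --> (0 : R)^'] --> 'D_1 f x by exact: df.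
move=> /nbhs_ballP[d /= d0 H].
have {}H (k : R) : `|k| < d -> k != 0 -> `|'D_1 f x * k - (f (k + x) - f x)| <= e * `|k|.
  move=> kd k0; have := H k; rewrite /ball/= sub0r normrN => /(_ kd k0).
  rewrite /GRing.scale/= mulr1 => K.
  rewrite (_ : _ - _ = ('D_1 f x - k^-1 * (f (k + x) - f x)) * k); last by field.
  by rewrite normrM ler_wpM2r// ltW.
exists d => // h /andP[h0 hd]; set a := 'D_1 f x.
have nh : `|h| = h by rewrite gtr0_norm.
have := H h; have := H (- h); rewrite normrN nh oppr_eq0 gt_eqF//.
move=> /(_ hd isT) + /(_ hd isT); rewrite -/a !ler_norml => /andP[m1 m2] /andP[p1 p2].
have [a0|a0] := ger0P a; split.
- by exists h; rewrite ?nh//; rewrite mulrBl; lra.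
- by exists (- h); rewrite ?normrN ?nh//; rewrite mulrBl; lra.
- by exists (- h); rewrite ?normrN ?nh//; rewrite mulrBl; lra.
- by exists h; rewrite ?nh//; rewrite mulrBl; lra.
Qed.

(* [g] need not be differentiable at [q]: the points [q + (k, 0)] and [q + (0, l)]
   with [|k|, |l| <= h] are at sup-distance at most [h]. *)
Lemma slope_bound (A : set (R * R)) g q : lipschitz2 A g -> interior A q ->
  `|dx g q| + `|dy g q| <= 2.
Proof.
move=> Lg Aq; have [c [r [r0 cq L]]] := Lg q (interior_subset Aq).
have : nbhs q (A `&` ball c r).
  apply: filterI; first exact: Aq.
  by apply: open_nbhs_nbhs; split => //; exact: ball_open.
move=> /nbhs_ballP[d /= d0 dA].
rewrite dxE dyE; set a := (X in `|X| + _); set b := (X in _ + `|X|).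
apply/ler_addgt0Pr => e e0; have e20 : 0 < e / 2 by rewrite divr_gt0.
have [d1 d10 H1] := derive_increment (fun x => g (x, q.2)) q.1 e20.
have [d2 d20 H2] := derive_increment (fun y => g (q.1, y)) q.2 e20.
pose h := Num.min d (Num.min d1 d2) / 2.
have m0 : 0 < Num.min d (Num.min d1 d2) by rewrite !lt_min d0 d10.
have h0 : 0 < h by rewrite divr_gt0.
have : h < Num.min d (Num.min d1 d2) by rewrite /h; lra.
rewrite !lt_min => /and3P[hd hd1 hd2].
have h01 : 0 < h < d1 by rewrite h0.
have h02 : 0 < h < d2 by rewrite h0.
(* A rise in the first variable is set against a fall in the second: the increments add up, while
   the two points are still at sup-distance at most [h]. *)
have [[k kh K] _] := H1 h h01; have [_ [l lh K']] := H2 h h02.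
rewrite -/a in K; rewrite -/b in K'.
have [A1 B1] : (A `&` ball c r) (k + q.1, q.2).
  apply: dA; split; rewrite /ball/= ?subrr ?normr0//.
  by rewrite opprD addrCA subrr addr0 normrN (le_lt_trans kh).
have [A2 B2] : (A `&` ball c r) (q.1, l + q.2).
  apply: dA; split; rewrite /ball/= ?subrr ?normr0//.
  by rewrite opprD addrCA subrr addr0 normrN (le_lt_trans lh).
have := L _ _ A1 A2 B1 B2; rewrite /=.
have -> : k + q.1 - q.1 = k by ring.
have -> : q.2 - (l + q.2) = - l by ring.
rewrite normrN => LL.
have M : Num.max `|k| `|l| <= h by rewrite ge_max kh.
have := ler_norm (g (k + q.1, q.2) - g (q.1, l + q.2)).
move: K K' LL; rewrite -!surjective_pairing => K K' LL ?.
rewrite -(ler_pM2r h0); lra.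
Qed.

End Slope.

Section Perturbation.
Context {R : realType}.
Implicit Types (f : R * R -> R) (U : set (R * R)).

(** As [lipschitz2] is local, the two regimes never have to be compared. Inside the larger ball the
    gradient bound suffices; around a point outside it, a ball of radius at most [r - r'] misses the
    modified region. *)
Lemma lipschitz2_on_ball (A : set (R * R)) f (g g1 g2 : R * R -> R) (p : R * R)
  (r r' a b : R) :
  0 < r' -> r' < r -> lipschitz2 A f ->
  (forall q, ~ ball p r' q -> g q = f q) ->
  grad_on (ball p r) g g1 g2 ->
  (forall q, ball p r q -> `|g1 q| <= a /\ `|g2 q| <= b) -> a + b <= 2 ->
  lipschitz2 A g.
Proof.
move=> r'0 r'r Lf gf Gg gab ab q Aq.
have [pq|npq] := pselect (ball p r q).
  exists p, r; split => //; first exact: lt_trans r'r.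
  move=> q1 q2 _ _ b1 b2.
  have [x1 [x2 [bx1 bx2 ->]]] := axis_mvt Gg (@subset_refl _ _) b2 b1.
  have [x1a _] := gab _ bx1; have [_ x2b] := gab _ bx2.
  set M := Num.max _ _.
  have M1 : `|q1.1 - q2.1| <= M by rewrite /M le_max lexx.
  have M2 : `|q1.2 - q2.2| <= M by rewrite /M le_max lexx orbT.
  have M0 : 0 <= M by apply: le_trans M1.
  apply: (@le_trans _ _ (a * M + b * M)).
    by apply: ler_norm_add2; rewrite normrM ler_pM.
  by rewrite -mulrDl ler_wpM2r.
have [c [s [s0 cq L]]] := Lf q Aq.
have /nbhs_ballP[d /= d0 dB] : nbhs q (ball c s).
  by apply: open_nbhs_nbhs; split => //; exact: ball_open.
pose d' := Num.min d (r - r').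
have d'0 : 0 < d' by rewrite lt_min d0 subr_gt0.
exists q, d'; split => //; first exact: ballxx.
have far z : ball q d' z -> g z = f z /\ ball c s z.
  move=> qz; split; last first.
    by apply: dB; apply: le_ball qz; rewrite ge_min lexx.
  apply: gf => pz; apply: npq.
  have zq : ball z (r - r') q.
    by apply: ball_sym; apply: le_ball qz; rewrite ge_min lexx orbT.
  by have := ball_triangle pz zq; rewrite addrC subrK.
move=> q1 q2 A1 A2 /far[-> ?] /far[-> ?]; exact: L.
Qed.

End Perturbation.

(** * The first variation *)

Section IntegrableComb.
Context d (T : measurableType d) {R : realType} (mu : {measure set T -> \bar R}).

Lemma integrableD_EFin (D : set T) (f g : T -> R) : measurable D ->
  mu.-integrable D (EFin \o f) -> mu.-integrable D (EFin \o g) ->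
  mu.-integrable D (EFin \o (fun x => f x + g x)).
Proof.
by move=> mD fi gi; have := integrableD mD fi gi; apply: eq_integrable => // x _.
Qed.

Lemma integrableZl_EFin (D : set T) (c : R) (f : T -> R) : measurable D ->
  mu.-integrable D (EFin \o f) -> mu.-integrable D (EFin \o (fun x => c * f x)).
Proof.
by move=> mD fi; have := integrableZl mD c fi; apply: eq_integrable => // x _.
Qed.

End IntegrableComb.

Section FirstVariation.
Context {R : realType}.
Notation mu := (@lebesgue_measure R).
Notation mu2 := (mu \x mu)%E.
Implicit Types (f : R * R -> R) (p q : R * R) (U : set (R * R)).

Lemma C1_grad_on U f : C1_on U f -> grad_on U f (dx f) (dy f).
Proof. by move=> H q /H[? ? _ _]; split; exact: derivableP. Qed.

Lemma bump2_in p r q : ball p r q ->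
  bump2x p r q = (-4 * (q.1 - p.1) * (r ^+ 2 - (q.1 - p.1) ^+ 2)) *
    (r ^+ 2 - (q.2 - p.2) ^+ 2) ^+ 2 /\
  bump2y p r q = (r ^+ 2 - (q.1 - p.1) ^+ 2) ^+ 2 *
    (-4 * (q.2 - p.2) * (r ^+ 2 - (q.2 - p.2) ^+ 2)).
Proof.
case; rewrite /ball/= ![`|p.1 - _|]distrC ![`|p.2 - _|]distrC => /bump_in[a1 a2]
  /bump_in[b1 b2].
by rewrite /bump2x /bump2y a1 a2 b1 b2.
Qed.

Definition affine (A B C : R) p q := A + B * (q.1 - p.1) + C * (q.2 - p.2).

(* [16 / 15 * r ^+ 5] is the integral of [bump r]. *)
Lemma integral_affine_bump2 (X0 Xx Xy Y0 Yx Yy : R) p r : 0 < r ->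
  let F q := affine X0 Xx Xy p q * bump2x p r q + affine Y0 Yx Yy p q * bump2y p r q in
  mu2.-integrable (ball p r) (EFin \o F) /\
  \int[mu2]_(q in ball p r) F q = - (Xx + Yy) * (16 / 15 * r ^+ 5) ^+ 2.
Proof.
move=> r0 F.
(* On the ball, [q2] is the bump, [q3] a multiple of its derivative, [q1] and [q5] its derivative
   times an affine factor, and [q4] the bump times its variable. The quintic [q4] only meets the odd
   [q3], whose integral is zero, so its own integral is never computed. *)
pose q1 x := quart 0 (-4 * r ^+ 2 * X0) (-4 * r ^+ 2 * Xx) (4 * X0) (4 * Xx) (x - p.1).
pose q2 (c x : R) := quart (r ^+ 4) 0 (-2 * r ^+ 2) 0 1 (x - c).
pose q3 (a c x : R) := quart 0 (-4 * r ^+ 2 * a) 0 (4 * a) 0 (x - c).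
pose q4 (c x : R) := quart 0 (r ^+ 4) 0 (-2 * r ^+ 2) 0 (x - c) + (x - c) ^+ 5.
pose q5 x := quart 0 (-4 * r ^+ 2 * Y0) (-4 * r ^+ 2 * Yy) (4 * Y0) (4 * Yy) (x - p.2).
have c4 c : continuous (q4 c).
  move=> x; apply: cvgD; first exact: continuous_quart.
  apply: (@continuous_comp _ _ _ (fun x : R => x - c) (fun u : R => u ^+ 5)).
    by apply: cvgB; [exact: cvg_id|exact: cvg_cst].
  exact: exprn_continuous.
have c1 : continuous q1 by exact: continuous_quart.
have c5 : continuous q5 by exact: continuous_quart.
have c2 c : continuous (q2 c) by exact: continuous_quart.
have c3 a c : continuous (q3 a c) by exact: continuous_quart.
pose T1 (q : R * R) := q1 q.1 * q2 p.2 q.2.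
pose T2 (q : R * R) := q3 Xy p.1 q.1 * q4 p.2 q.2.
pose T3 (q : R * R) := q2 p.1 q.1 * q5 q.2.
pose T4 (q : R * R) := q4 p.1 q.1 * q3 Yx p.2 q.2.
have FE q : ball p r q -> F q = T1 q + T2 q + (T3 q + T4 q).
  move=> /bump2_in[bx by_]; rewrite /F bx by_ /T1 /T2 /T3 /T4 /affine /q1 /q2 /q3
    /q4 /q5 /quart.
  by move: (q.1 - p.1) (q.2 - p.2) => u v; ring.
have i1 : mu2.-integrable (ball p r) (EFin \o T1) by exact: integrable_ball_prod.
have i2 : mu2.-integrable (ball p r) (EFin \o T2) by exact: integrable_ball_prod.
have i3 : mu2.-integrable (ball p r) (EFin \o T3) by exact: integrable_ball_prod.
have i4 : mu2.-integrable (ball p r) (EFin \o T4) by exact: integrable_ball_prod.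
have i12 : mu2.-integrable (ball p r) (EFin \o (fun q => T1 q + T2 q)).
  by apply: integrableD_EFin => //; exact: measurable_ball2.
have i34 : mu2.-integrable (ball p r) (EFin \o (fun q => T3 q + T4 q)).
  by apply: integrableD_EFin => //; exact: measurable_ball2.
have FE' : {in (ball p r : set (R * R)), (fun q => T1 q + T2 q + (T3 q + T4 q)) =1 F}.
  by move=> q; rewrite inE => /FE.
split.
  have : mu2.-integrable (ball p r) (EFin \o (fun q => T1 q + T2 q + (T3 q + T4 q))).
    by apply: integrableD_EFin => //; exact: measurable_ball2.
  apply: eq_integrable => [|q qB]; first exact: measurable_ball2.
  by rewrite /= FE'.
transitivity (\int[mu2]_(q in ball p r) (T1 q + T2 q + (T3 q + T4 q))).
  by apply: eq_Rintegral => q qB; rewrite FE'.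
rewrite RintegralD//; last exact: measurable_ball2.
rewrite RintegralD//; last exact: measurable_ball2.
rewrite RintegralD//; last exact: measurable_ball2.
rewrite !Rintegral_ball_prod// /q1 /q2 /q3 /q5.
by rewrite !Rintegral_quart//; field.
Qed.

(** The mean value theorem writes the increment of [ent] with its gradient at intermediate points,
    and [taylor_comp] expands that gradient at [p]. Four coefficients are left existential because
    they drop out of the integral against the bump. *)
Lemma first_variation f p U : open U -> U p -> C2_on U f -> `|dx f p| + `|dy f p| < 2 ->
  let s := dx f p in let t := dy f p in
  exists X0 Xy Y0 Yx : R,
  let Xx := ent11 s t * dx (dx f) p + ent12 s t * dx (dy f) p in
  let Yy := ent12 s t * dy (dx f) p + ent11 t s * dy (dy f) p in
  forall e : R, 0 < e -> exists2 k : R, 0 < k <= 1 & exists2 d : R, 0 < d &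
  forall (r : R) q (w : R * R), 0 < r <= d -> ball p r q -> `|w.1| < k * r ->
    `|w.2| < k * r ->
    `|ent (dx f q + w.1) (dy f q + w.2) - ent (dx f q) (dy f q)
      - (affine X0 Xx Xy p q * w.1 + affine Y0 Yx Yy p q * w.2)|
    <= e * r * (`|w.1| + `|w.2|).
Proof.
move=> oU Up [C1f C1x C1y] st s t.
have [cfx cfy] : {for p, continuous (dx f)} /\ {for p, continuous (dy f)}.
  by have [] := C1f p Up.
have [_ _ cxx cxy] := C1x p Up; have [_ _ cyx cyy] := C1y p Up.
have Gx := C1_grad_on C1x; have Gy := C1_grad_on C1y.
have P : ent_dom (dx f p, dy f p) by [].
have T e (e0 : 0 < e) := taylor_comp oU Up Gx Gy cxx cxy cyx cyy (open_ent_dom (R := R)) P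
  (@grad_ent1 R) (continuous_ent11 P) (continuous_ent12 P) e0.
have T' e (e0 : 0 < e) := taylor_comp oU Up Gx Gy cxx cxy cyx cyy (open_ent_dom (R := R)) P
  (@grad_ent2 R) (continuous_ent12 P) (continuous_ent22 P) e0.
rewrite /= -/s -/t in T T'.
exists (ent1 s t), (ent11 s t * dy (dx f) p + ent12 s t * dy (dy f) p),
  (ent1 t s), (ent12 s t * dx (dx f) p + ent11 t s * dx (dy f) p).
move=> Xx Yy e e0.
have [k1 k10 [d1 d10 H1]] := T e e0; have [k2 k20 [d2 d20 H2]] := T' e e0.
(* Each slope moves by at most [eta] from [p] to [q] and by at most [eta] more within the ball
   around the slopes at [q]. In total this uses half of the gap to the slope bound 2. *)
pose eta := (2 - (`|s| + `|t|)) / 8.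
have eta0 : 0 < eta by rewrite divr_gt0// subr_gt0.
have /continuous_pairP/(_ _ eta0)[d3 d30 H3] := cfx.
have /continuous_pairP/(_ _ eta0)[d4 d40 H4] := cfy.
exists (Num.min 1 (Num.min k1 k2)); first by rewrite !lt_min ltr01 k10 k20 ge_min lexx.
exists (Num.min eta (Num.min (Num.min d1 d2) (Num.min d3 d4))).
  by rewrite !lt_min eta0 d10 d20 d30 d40.
set k := Num.min 1 _.
have [k_1 kk1 kk2] : [/\ k <= 1, k <= k1 & k <= k2].
  by rewrite /k !ge_min !lexx !orbT.
move=> r q w /andP[r0]; rewrite !le_min =>
  /and3P[reta /andP[rd1 rd2] /andP[rd3 rd4]] pq w1 w2.
have {}H3 := H3 _ (le_ball rd3 pq); have {}H4 := H4 _ (le_ball rd4 pq).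
have kr : 0 < k * r by apply: le_lt_trans w1.
have kr_r : k * r <= r by rewrite ler_piMl// ltW.
pose c := (dx f q, dy f q).
have sub : ball c (k * r) `<=` ent_dom.
  move=> z [z1 z2]; rewrite /ent_dom /=.
  have b (a b' z' : R) : `|a - b'| < eta -> `|b' - z'| < k * r -> `|z'| <= `|a| + 2 * eta.
    move=> h1 h2; have : `|z' - a| <= eta + eta.
      apply: le_trans (ler_distD b' _ _) _; rewrite distrC [X in _ + X]distrC.
      by apply: lerD; apply: ltW => //; apply: lt_le_trans h2 (le_trans kr_r reta).
    have := ler_normD (z' - a) a; rewrite subrK; lra.
  have := b _ _ _ H3 z1; have := b _ _ _ H4 z2; rewrite -/s -/t /eta /=; move: st;
    rewrite -/s -/t; lra.
have cw : ball c (k * r) (dx f q + w.1, dy f q + w.2).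
  by split; rewrite /ball/= opprD addNKr normrN.
have [x1 [x2 [bx1 bx2 /= ->]]] := axis_mvt (@grad_ent R) sub (ballxx c kr) cw.
have aff A B C : affine A B C p q = A + (B * (q.1 - p.1) + C * (q.2 - p.2)).
  by rewrite /affine addrA.
have {}H1 : `|ent1 x1.1 x1.2 - affine (ent1 s t) Xx
  (ent11 s t * dy (dx f) p + ent12 s t * dy (dy f) p) p q| <= e * r.
  rewrite aff opprD addrA.
  exact: H1 r q x1 rd1 pq (le_ball (ler_wpM2r (ltW r0) kk1) bx1).
have {}H2 : `|ent1 x2.2 x2.1 - affine (ent1 t s)
  (ent12 s t * dx (dx f) p + ent11 t s * dx (dy f) p) Yy p q| <= e * r.
  rewrite aff opprD addrA.
  exact: H2 r q x2 rd2 pq (le_ball (ler_wpM2r (ltW r0) kk2) bx2).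
rewrite (_ : dx f q + w.1 - dx f q = w.1); last by rewrite addrAC subrr add0r.
rewrite (_ : dy f q + w.2 - dy f q = w.2); last by rewrite addrAC subrr add0r.
rewrite opprD addrACA -!mulrBl mulrDr.
by apply: ler_norm_add2; rewrite normrM ler_wpM2r.
Qed.

End FirstVariation.

Section Modify.
Context d (T : measurableType d) {R : realType} (mu : {measure set T -> \bar R}).

(** The parts of the two integrals off [S] may be those of a nonmeasurable function, but they are
    the same real number and cancel. *)
Lemma Rintegral_lt_modify (D S : set T) (F1 F2 G : T -> R) (M : R) :
  measurable D -> measurable S -> S `<=` D -> (mu D < +oo)%E ->
  (forall x, D x -> `|F1 x| <= M) -> (forall x, D x -> `|F2 x| <= M) ->
  (forall x, D x -> ~ S x -> F1 x = F2 x) ->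
  mu.-integrable S (EFin \o F1) -> mu.-integrable S (EFin \o F2) ->
  mu.-integrable S (EFin \o G) ->
  (forall x, S x -> F1 x + G x <= F2 x) ->
  0 < \int[mu]_(x in S) G x ->
  \int[mu]_(x in D) F1 x < \int[mu]_(x in D) F2 x.
Proof.
move=> mD mS SD Dfin M1 M2 F12 i1 i2 iG FG G0.
rewrite (bounded_integral_split mD mS Dfin M1) (bounded_integral_split mD mS Dfin M2).
rewrite (_ : D `&` S = S); last exact/setIidPr.
rewrite (_ : \int[mu]_(x in D `&` ~` S) F1 x = \int[mu]_(x in D `&` ~` S) F2 x); last first.
  by apply: eq_Rintegral => x; rewrite inE => -[Dx nSx]; exact: F12.
rewrite ltrD2r; apply: (@lt_le_trans _ _ (\int[mu]_(x in S) (F1 x + G x))).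
  by rewrite RintegralD// ltrDl.
apply: le_Rintegral => //.
have := integrableD mS i1 iG; apply: eq_integrable => // x _.
Qed.

End Modify.

Section EntropyOnBalls.
Context {R : realType}.
Notation mu := (@lebesgue_measure R).
Notation mu2 := (mu \x mu)%E.

Lemma compact_measurable2 (A : set (R * R)) : compact A ->
  measurable A /\ (mu2 A < +oo)%E.
Proof.
move=> cA.
have mA : measurable A.
  rewrite -[A]setCK; apply: measurableC; apply: open_measurable2.
  by apply: closed_openC; apply: compact_closed => //; exact: norm_hausdorff.
split => //.
have [M [_ HM]] := compact_bounded cA.
pose N := `|M| + 2.
have N0 : 0 < N by rewrite /N ltr_wpDl.
have AB : A `<=` ball (0 : R * R) N.
  move=> q Aq; rewrite -ball_normE /ball_/= sub0r normrN.
  have : `|q| <= `|M| + 1 by apply: HM Aq; have := ler_norm M; lra.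
  by rewrite /N; lra.
apply: (@le_lt_trans _ _ ((2 * N) ^+ 2)%:E); last exact: ltry.
rewrite -(mu2_ball 0 N0); apply: le_measure => //; rewrite inE //.
exact: measurable_ball2.
Qed.

Lemma area_gt0 (A : set (R * R)) p r : compact A -> 0 < r -> ball p r `<=` A -> 0 < area A.
Proof.
move=> cA r0 pA; have [mA Afin] := compact_measurable2 cA.
apply: fine_gt0; apply/andP; split => //.
apply: (@lt_le_trans _ _ ((2 * r) ^+ 2)%:E).
  by rewrite lte_fin exprn_gt0// mulr_gt0.
rewrite -(mu2_ball p r0); apply: le_measure => //; rewrite inE //.
exact: measurable_ball2.
Qed.

(** Two applications of the criterion that continuous partial derivatives imply continuity: from the
    second derivatives to the gradient, and from the gradient to [ent]. *)
Lemma continuous_ent (P : R * R) : ent_dom P ->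
  {for P, continuous (fun q : R * R => ent q.1 q.2)}.
Proof.
move=> dP; apply: (grad_continuous (open_ent_dom (R := R)) dP (@grad_ent R)).
  exact: (grad_continuous (open_ent_dom (R := R)) dP (@grad_ent1 R)
    (continuous_ent11 dP) (continuous_ent12 dP)).
exact: (grad_continuous (open_ent_dom (R := R)) dP (@grad_ent2 R)
  (continuous_ent12 dP) (continuous_ent22 dP)).
Qed.

Lemma integrable_ent_ball (u v : R * R -> R) p r : 0 < r ->
  (forall q, ball p r q -> [/\ {for q, continuous u}, {for q, continuous v} & `|u
    q| + `|v q| < 2]) ->
  mu2.-integrable (ball p r) (EFin \o (fun q => ent (u q) (v q))).
Proof.
move=> r0 H; have [M HM] := ent_bounded (R := R).
apply: (@bounded_integrable_ball _ _ _ _ M) => // q /H[cu cv uv]; last exact/HM/ltW.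
apply: (@continuous_comp _ _ _ (fun q => (u q, v q)) (fun q : R * R => ent q.1 q.2)).
  exact: (cvg_pair cu cv).
exact: continuous_ent.
Qed.

End EntropyOnBalls.

Section Competitor.
Context {R : realType}.
Implicit Types (f : R * R -> R) (p q : R * R) (U : set (R * R)).

Definition perturb f p (r e : R) q := f q + e * bump2 p r q.

Lemma grad_perturb U f f1 f2 p r e : grad_on U f f1 f2 ->
  grad_on U (perturb f p r e) (fun q => f1 q + e * bump2x p r q)
    (fun q => f2 q + e * bump2y p r q).
Proof.
move=> Gf q Uq; have [D1 D2] := Gf q Uq; have [B1 B2] := grad_bump2 p r (I : setT q).
by split; [exact: (is_deriveD D1 (is_deriveZ e B1))|exact:
  (is_deriveD D2 (is_deriveZ e B2))].
Qed.

Lemma near_perturb f p r r' e q : 0 < r -> r < r' -> ~ ball p r' q ->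
  \near q, perturb f p r e q = f q.
Proof.
move=> r0 rr' nq; apply/nbhs_ballP; exists (r' - r); rewrite /= ?subr_gt0// => z qz.
have nz : ~ ball p r z.
  move=> pz; apply: nq; have := ball_triangle pz (ball_sym qz).
  by rewrite addrC subrK.
by rewrite /perturb; have [-> _ _] := bump2_out r0 nz; rewrite mulr0 addr0.
Qed.

End Competitor.

(** * A competitor with larger entropy *)

Section EulerLagrange.
Context {R : realType}.
Notation mu := (@lebesgue_measure R).
Notation mu2 := (mu \x mu)%E.
Implicit Types (f : R * R -> R) (p q : R * R) (U : set (R * R)).

Let slope_margin (a b : R) : a + b < 2 -> exists eta,
  [/\ 0 < eta, a + eta + (b + eta) < 2 & a + 2 * eta + (b + 2 * eta) < 2].
Proof. by move=> ab; exists ((2 - (a + b)) / 8); split; lra. Qed.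

Let exists_le3 (a b c : R) : 0 < a -> 0 < b -> 0 < c ->
  exists r, [/\ 0 < r, r <= a, r <= b & r <= c].
Proof.
move=> a0 b0 c0; exists (Num.min a (Num.min b c)).
by rewrite !lt_min a0 b0 c0 !ge_min !lexx !orbT.
Qed.

Let half_lt (x : R) : 0 < x -> x / 2 < x.
Proof. by move=> x0; lra. Qed.

Let norm_le_dist (x y eta : R) : `|x - y| < eta -> `|y| <= `|x| + eta.
Proof. by move=> xy; have := ler_normB x (x - y); rewrite subKr; lra. Qed.

Let norm_add_margin (x y c z eta : R) : z <= eta -> 0 < z ->
  `|x| <= c + eta -> `|y| <= z / 2 -> `|x + y| <= c + 2 * eta.
Proof. by move=> ze z0 xc yz; apply: le_trans (ler_norm_add2 xc yz) _; lra. Qed.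

(** Here [z] is [8 * e1 * r ^+ 7], so the error is half of [e1 * T * r ^+ 10], while the gain is
    256/225 of it; 287/450 is the difference. The factor 64 is what makes the error smaller than the
    gain. *)
Let gain_gt0 (e1 T r z : R) : 0 < e1 -> 0 < T -> 0 < r -> z / 2 = e1 * (4 * r ^+ 7) ->
  0 < e1 * T * (16 / 15 * r ^+ 5) ^+ 2 + - (T / 64 * r * z) * (2 * r) ^+ 2.
Proof.
move=> e0 T0 r0 zE.
have -> : z = 2 * (e1 * (4 * r ^+ 7)) by rewrite -zE; field.
have -> : e1 * T * (16 / 15 * r ^+ 5) ^+ 2 + -
  (T / 64 * r * (2 * (e1 * (4 * r ^+ 7)))) * (2 * r) ^+ 2
  = e1 * T * r ^+ 10 * (287 / 450) by field.
have c0 : 0 < 287 / 450 :> R by rewrite divr_gt0 ?ltr0n.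
exact: mulr_gt0 (mulr_gt0 (mulr_gt0 e0 T0) (exprn_gt0 10 r0)) c0.
Qed.

Let lower_bound_scaled (m1 m2 E1 E2 c b1 b2 a1 a2 : R) :
  - m1 <= E1 - E2 - (a1 * (c * b1) + a2 * (c * b2)) -> m1 <= m2 ->
  E2 + (c * (a1 * b1 + a2 * b2) - m2) <= E1.
Proof. by move=> H m12; rewrite mulrDr !(mulrCA c); lra. Qed.

Lemma integrable_ball_cst (c : R) p r : 0 < r ->
  mu2.-integrable (ball p r) (EFin \o (fun=> c)).
Proof.
by move=> r0; apply: (@bounded_integrable_ball _ _ _ _ `|c|) => // q _; exact: cvg_cst.
Qed.

Lemma Rintegral_ball_cst (c : R) p r : 0 < r ->
  \int[mu2]_(q in ball p r) c = c * (2 * r) ^+ 2.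
Proof.
move=> r0; rewrite Rintegral_cst; last exact: measurable_ball2.
by rewrite (_ : fine _ = (2 * r) ^+ 2)// -[RHS]/(fine ((2 * r) ^+ 2)%:E) -(mu2_ball p r0).
Qed.

Lemma AH_perturb (A U : set (R * R)) hb f p (r r' e a b : R) :
  open U -> U `<=` A -> ball p r' `<=` U -> 0 < r < r' -> AH A hb f ->
  C1_on U f ->
  (forall q, ball p r' q -> `|dx f q + e * bump2x p r q| <= a /\
                            `|dy f q + e * bump2y p r q| <= b) ->
  a + b <= 2 -> AH A hb (perturb f p r e).
Proof.
move=> oU UA pU /andP[r0 rr'] [Lf bf] Cf bnd ab; split.
  apply: (lipschitz2_on_ball r0 rr' Lf _ _ bnd ab).
    by move=> q /(bump2_out r0)[b0 _ _]; rewrite /perturb b0 mulr0 addr0.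
  by apply: grad_perturb => q /pU; exact: C1_grad_on.
move=> q Bq; rewrite -bf// /perturb.
(* A point of the ball lies in the open set [U] inside [A], hence in the interior, which the
   boundary excludes. *)
have nq : ~ ball p r q.
  move=> pq; case: Bq => _; apply.
  have Uq : U q by apply: pU; exact: le_ball (ltW rr') _ pq.
  by apply: filterS UA _; exact: open_nbhs_nbhs.
by have [-> _ _] := bump2_out r0 nq; rewrite mulr0 addr0.
Qed.

(** In [U] the derivative formula applies and the gradient of the bump vanishes, including on the
    edge of the ball. Outside [U], where [f] may fail to be differentiable, both functions agree
    near [q], so even default values coincide. *)
Lemma perturb_grad_out U f p (r r' e : R) q : open U -> C1_on U f ->
  ball p r' `<=` U -> 0 < r < r' -> ~ ball p r q ->
  dx (perturb f p r e) q = dx f q /\ dy (perturb f p r e) q = dy f q.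
Proof.
move=> oU Cf pU /andP[r0 rr'] nq; have [Uq|nUq] := pselect (U q).
  have [[_ dE] [_ dE']] := grad_perturb p r e (C1_grad_on Cf) Uq.
  rewrite /dx /dy dE dE'; have [_ -> ->] := bump2_out r0 nq.
  by rewrite !mulr0 !addr0.
have np : \near q, perturb f p r e q = f q.
  by apply: near_perturb r0 rr' _ => /pU.
by split; apply: near_eq_derive.
Qed.

Lemma entropy_increase (A U : set (R * R)) hb f p :
  compact A -> open U -> U p -> U `<=` A -> AH A hb f -> C2_on U f ->
  `|dx f p| + `|dy f p| < 2 ->
  let s := dx f p in let t := dy f p in
  let Xx := ent11 s t * dx (dx f) p + ent12 s t * dx (dy f) p in
  let Yy := ent12 s t * dy (dx f) p + ent11 t s * dy (dy f) p in
  Xx + Yy != 0 ->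
  exists2 h, AH A hb h & Ent A f < Ent A h.
Proof.
move=> cA oU Up UA AHf C2f st s t Xx Yy; set T := Xx + Yy => T0.
have nT0 : 0 < `|T| by rewrite normr_gt0.
have [X0 [Xy [Y0 [Yx FV]]]] := first_variation oU Up C2f st.
have e0 : 0 < `|T| / 64 by rewrite divr_gt0.
have {FV} [k /andP[k0 k1] [d d0 FV]] := FV _ e0.
rewrite -[X in affine X0 X]/Xx -[X in affine Y0 Yx X]/Yy in FV.
clearbody Xx Yy.
have [C1f _ _] := C2f.
have [eta [eta0 sum2 sum4]] := slope_margin st.
have [_ _ /continuous_pairP/(_ _ eta0)[d3 d30 H3]
  /continuous_pairP/(_ _ eta0)[d4 d40 H4]] := C1f p Up.
have /nbhs_ballP[d5 /= d50 H5] : nbhs p U by exact: open_nbhs_nbhs.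
(* The slopes of [f] are controlled on the ball of radius [r']. The bump gets at most half that
   radius, and the collar lets the competitor coincide with [f] near every point outside the larger
   ball. *)
have [r' [r'0 r'5 r'3 r'4]] := exists_le3 d50 d30 d40.
have r'20 : 0 < r' / 2 by rewrite divr_gt0.
have [r [r0 rr'2 rd reta]] := exists_le3 r'20 d0 eta0.
have rr' : r < r' := le_lt_trans rr'2 (half_lt r'0).
have pU : ball p r' `<=` U by exact: subset_trans (le_ball r'5) H5.
pose B := 4 * r ^+ 7.
have B0 : 0 < B by rewrite mulr_gt0// exprn_gt0.
(* This uses half of the admissible slope shift [k * r], because the expansion asks for a strict
   inequality. *)
pose e1 := k * r / (2 * B).
have e10 : 0 < e1 by rewrite divr_gt0// mulr_gt0.
pose e := - Num.sg T * e1.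
have ne : `|e| = e1 by rewrite normrM normrN normr_sg T0 mul1r gtr0_norm.
have eT : e * T = - (e1 * `|T|) by rewrite /e normrEsg; ring.
clearbody e.
have eB : e1 * B = k * r / 2 by rewrite /e1; field; rewrite gt_eqF.
have kr0 : 0 < k * r by rewrite mulr_gt0.
have kr_eta : k * r <= eta by apply: le_trans reta; rewrite ler_piMl// ltW.
have half := half_lt kr0.
have small q : `|e * bump2x p r q| <= k * r / 2 /\ `|e * bump2y p r q| <= k * r / 2.
  have [bx by_] := bump2_bounds p q r0.
  by rewrite (normrM e (bump2x _ _ _)) (normrM e (bump2y _ _ _)) ne -eB !ler_wpM2l// ltW.
pose h := perturb f p r e.
pose hx q := dx f q + e * bump2x p r q; pose hy q := dy f q + e * bump2y p r q.
have bnd q : ball p r' q -> `|dx f q| <= `|s| + eta /\ `|dy f q| <= `|t| + eta.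
  move=> pq; split; first exact: norm_le_dist (H3 _ (le_ball r'3 pq)).
  exact: norm_le_dist (H4 _ (le_ball r'4 pq)).
have hbnd q : ball p r' q -> `|hx q| <= `|s| + 2 * eta /\ `|hy q| <= `|t| + 2 * eta.
  move=> /bnd[b1 b2]; have [s1 s2] := small q.
  by split; [exact: norm_add_margin b1 s1|exact: norm_add_margin b2 s2].
have AHh : AH A hb h.
  apply: (AH_perturb oU UA pU _ AHf C1f hbnd); first by rewrite r0.
  exact: ltW.
have Uint : U `<=` interior A by move=> q Uq; apply: filterS UA _; exact: open_nbhs_nbhs.
have pA : ball p r `<=` interior A.
  by move=> q pq; apply: Uint; apply: pU; exact: le_ball (ltW rr') _ pq.
exists h => //; rewrite /Ent ltr_pM2l; last first.
  rewrite invr_gt0; apply: (area_gt0 cA r0).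
  by move=> q /pA/interior_subset; exact.
have [M HM] := ent_bounded (R := R).
have FM g q : AH A hb g -> interior A q -> `|ent (dx g q) (dy g q)| <= M.
  by move=> [Lg _] Aq; apply: HM; exact: slope_bound Lg Aq.
(* The lower bound for the pointwise gain, with the sum of the two slope shifts in the error
   replaced by its bound [k * r]. *)
pose G q := e * (affine X0 Xx Xy p q * bump2x p r q + affine Y0 Yx Yy p q * bump2y p r q)
  - `|T| / 64 * r * (k * r).
have [iG0 IG0] := integral_affine_bump2 X0 Xx Xy Y0 Yx Yy p r0.
have ieG : mu2.-integrable (ball p r) (EFin \o (fun q => e *
    (affine X0 Xx Xy p q * bump2x p r q + affine Y0 Yx Yy p q * bump2y p r q))).
  by apply: integrableZl_EFin => //; exact: measurable_ball2.
have iC := integrable_ball_cst (- (`|T| / 64 * r * (k * r))) p r0.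
have oA : open (interior A) by exact: open_interior.
have hE q : ball p r q -> dx h q = hx q /\ dy h q = hy q.
  move=> pq; have Uq : U q by apply: pU; exact: le_ball (ltW rr') _ pq.
  by have [[_ ?] [_ ?]] := grad_perturb p r e (C1_grad_on C1f) Uq.
have pr' q : ball p r q -> ball p r' q by move=> pq; exact: le_ball (ltW rr') _ pq.
apply: (@Rintegral_lt_modify _ _ R mu2 (interior A) (ball p r) _ _ G M).
- exact: open_measurable2.
- exact: measurable_ball2.
- exact: pA.
- apply: le_lt_trans (compact_measurable2 cA).2; apply: le_measure; rewrite ?inE.
  + exact: open_measurable2.
  + exact: (compact_measurable2 cA).1.
  + exact: interior_subset.
- by move=> q; exact: FM.
- by move=> q; exact: FM.
- move=> q _ nq; have [|-> ->] := @perturb_grad_out U f p r r' e q oU C1f pU _ nq => //.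
  by rewrite r0.
- apply: integrable_ent_ball => // q pq; have [_ _ c1 c2] := C1f q (pU _ (pr' _ pq)).
  split; [exact: c1|exact: c2|]; have [b1 b2] := bnd q (pr' _ pq).
  exact: le_lt_trans (lerD b1 b2) sum2.
- have ih : mu2.-integrable (ball p r) (EFin \o (fun q => ent (hx q) (hy q))).
    apply: integrable_ent_ball => // q pq; have [_ _ c1 c2] := C1f q (pU _ (pr' _ pq)).
    split.
    + by apply: cvgD; [exact: c1|apply: cvgM; [exact: cvg_cst|exact: continuous_bump2x]].
    + by apply: cvgD; [exact: c2|apply: cvgM; [exact: cvg_cst|exact: continuous_bump2y]].
    + have [b1 b2] := hbnd q (pr' _ pq).
        exact: le_lt_trans (lerD b1 b2) sum4.
  apply: eq_integrable ih => [|q]; first exact: measurable_ball2.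
  by rewrite inE => /hE[e1' e2']; rewrite /= e1' e2'.
- by apply: integrableD_EFin => //; exact: measurable_ball2.
- move=> q pq; have [-> ->] := hE q pq.
  have [s1 s2] := small q.
  have w1 := le_lt_trans s1 half; have w2 := le_lt_trans s2 half.
  have rd0 : 0 < r <= d by rewrite r0.
  have := FV r q (e * bump2x p r q, e * bump2y p r q) rd0 pq w1 w2.
  rewrite ler_norml => /andP[FVq _]; apply: lower_bound_scaled FVq _.
  rewrite ler_wpM2l//; first by rewrite mulr_ge0 ?ltW.
  by rewrite [leRHS]splitr lerD.
- rewrite /G RintegralD//; last exact: measurable_ball2.
  rewrite RintegralZl//; last exact: measurable_ball2.
  rewrite IG0 Rintegral_ball_cst// -/T.
  rewrite mulrA mulrN eT opprK; apply: gain_gt0 => //; rewrite eB//.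
Qed.

End EulerLagrange.

Theorem theorem12p1 (R : realType) (Rs : set (R * R)) (gamma : R -> R * R)
    (hb f : R * R -> R) (p : R * R) (U : set (R * R))
    (gamma_simple : simple_closed gamma)
    (gamma_smooth : piecewise_smooth gamma)
    (Rs_region : region_bounded_by Rs gamma)
    (hb_height : boundary_asymptotic_height Rs hb)
    (f_max : is_maximizer Rs hb f)
    (p_int : interior Rs p)
    (U_nbhs : open_nbhs p U)
    (U_sub : U `<=` Rs)
    (f_C2 : C2_on U f)
    (f_slope : `|dx f p| + `|dy f p| < 2) :
  let D := (cos (pi * dx f p / 2) - cos (pi * dy f p / 2)) / 2 in
  (2 * (1 - D ^+ 2) - sin (pi * dx f p / 2) ^+ 2) * dx (dx f) p
  + 2 * sin (pi * dx f p / 2) * sin (pi * dy f p / 2) * dy (dx f) p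
  + (2 * (1 - D ^+ 2) - sin (pi * dy f p / 2) ^+ 2) * dy (dy f) p = 0.
Proof.
have [oU Up] := U_nbhs; have [cRs _ _ _ _] := Rs_region; have [fAH fmax] := f_max.
have [C1f C1x C1y] := f_C2.
apply: (euler_lagrange_coef f_slope).
have [_ _ _ cxy] := C1x p Up; have [_ _ cyx _] := C1y p Up.
have sym := schwarz oU Up (C1_grad_on C1f) (C1_grad_on C1x) (C1_grad_on C1y) cxy cyx.
(* The divergence contains one mixed derivative in each order, whereas [euler_lagrange_coef] has the
   same one twice. *)
rewrite {1}sym; apply/eqP; apply/negPn/negP => EL0.
have [h hAH] := entropy_increase cRs oU Up U_sub fAH f_C2 f_slope EL0.
by rewrite ltNge fmax.
Qed.
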